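(* Let $n,d\ge 1$ be integers. The assignment $\psi: t_i\mapsto \mathsf{t}_i$ ($1\le i\le n-1$), $z_j\mapsto \mathsf{o}_j$ ($1\le j\le n$) extends to a monoid isomorphism $J_{d,n}\to \mathring{J}_{d,n}$ from the framed Jones monoid to the abacus Jones monoid. In particular $|J_{d,n}| = d^n\, Cat_n$, where $Cat_n=\frac{1}{n+1}\binom{2n}{n}$.
   Context: Framed Jones monoid: $J_{d,n}$ is the monoid presented by generators $t_1,\dots,t_{n-1},z_1,\dots,z_n$ and relations (whenever the indices make sense): $t_i^2=t_i$; $t_it_j=t_jt_i$ if $|i-j|>1$; $t_it_jt_i=t_i$ if $|i-j|=1$; $z_i^d=1$; $z_iz_j=z_jz_i$; $t_iz_i=t_iz_{i+1}$; $z_it_i=z_{i+1}t_i$; $z_it_j=t_jz_i$ for $i\ne j,j+1$; $t_iz_i^kt_i=t_i$ for all $k$. Abacus Jones monoid: a Jones diagram consists of $n$ pairwise noncrossing arcs (up to isotopy) drawn between two parallel horizontal lines, whose $2n$ endpoints are the points $1,\dots,n$ of the top line and the points $1,\dots,n$ of the bottom line. The elements of $\mathring{J}_{d,n}$ are the Jones diagrams in which each arc carries a number of beads in $\{0,\dots,d-1\}$; beads slide freely along their arc. The product $ab$ is obtained by placing $a$ above $b$ and concatenating; the numbers of beads on arcs that get joined are added modulo $d$, and closed loops (with or without beads) are discarded. The element $\mathsf{t}_i$ is the diagram without beads having one arc joining the top points $i,i+1$, one arc joining the bottom points $i,i+1$, and vertical arcs joining top $j$ to bottom $j$ for all other $j$.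 The element $\mathsf{o}_i$ is the identity diagram ($n$ vertical arcs) with a single bead, on the $i$-th arc (when $d=1$, beads are counted modulo $1$, so $\mathsf{o}_i$ is the identity). *)

(* Defs.v *)
From HB Require Import structures.
From mathcomp Require Import all_boot all_algebra zify.
From mathcomp Require Import boolp classical_sets functions cardinality.

Set Implicit Arguments.
Unset Strict Implicit.
Unset Printing Implicit Defensive.

(** The monoid congruence on the free monoid [seq A] generated by the pairs
    [(u, v)] such that [R u v]. *)
Inductive congruence (A : Type) (R : seq A -> seq A -> Prop) :
    seq A -> seq A -> Prop :=
| cong_rel u v : R u v -> congruence R u v
| cong_refl u : congruence R u u
| cong_sym u v : congruence R u v -> congruence R v u
| cong_trans u v w : congruence R u v -> congruence R v w -> congruence R u w
| cong_cat u u' v v' :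
    congruence R u u' -> congruence R v v' -> congruence R (u ++ v) (u' ++ v').

Section Presented.
Variables (A : choiceType) (R : seq A -> seq A -> Prop).

Definition congb : rel (seq A) := fun u v => `[< congruence R u v >].

Lemma congb_refl : reflexive congb.
Proof. by move=> u; apply/asboolP; apply: cong_refl. Qed.

Lemma congb_sym : symmetric congb.
Proof.
by move=> u v; apply/idP/idP => /asboolP h; apply/asboolP; apply: cong_sym.
Qed.

Lemma congb_trans : transitive congb.
Proof.
by move=> v u w /asboolP h1 /asboolP h2; apply/asboolP; apply: cong_trans h1 h2.
Qed.

Canonical congb_equiv := EquivRel congb congb_refl congb_sym congb_trans.

Local Open Scope quotient_scope.

Definition presented := {eq_quot congb_equiv}.

HB.instance Definition _ := Choice.on presented.

Definition word (w : seq A) : presented := \pi w.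
Definition gen (a : A) : presented := word [:: a].

Lemma wordP u v : word u = word v <-> congruence R u v.
Proof.
by split=> [/eqmodP/asboolP|/asboolP h]; last exact/eqmodP.
Qed.

Definition presented_mul (x y : presented) : presented :=
  word (repr x ++ repr y).

Lemma word_cat u v : presented_mul (word u) (word v) = word (u ++ v).
Proof.
by apply/wordP; apply: cong_cat; apply/wordP; rewrite /word reprK.
Qed.

Lemma word_surj (x : presented) : exists w, x = word w.
Proof. by exists (repr x); rewrite /word reprK. Qed.

Lemma presented_mulA : associative presented_mul.
Proof.
move=> x y z; have [u ->] := word_surj x; have [v ->] := word_surj y.
by have [w ->] := word_surj z; rewrite !word_cat catA.
Qed.

Lemma presented_mul1 : left_id (word [::]) presented_mul.
Proof. by move=> x; have [u ->] := word_surj x; rewrite word_cat. Qed.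

Lemma presented_mulr1 : right_id (word [::]) presented_mul.
Proof. by move=> x; have [u ->] := word_surj x; rewrite word_cat cats0. Qed.

HB.instance Definition _ :=
  isMonoid.Build presented presented_mulA presented_mul1 presented_mulr1.

End Presented.

(** Strands are numbered from [0]: the position [i : 'I_n.-1] stands for the
    pair of neighbouring strands [ord_lo i = i] and [ord_hi i = i + 1]. *)
Definition ord_lo n (i : 'I_n.-1) : 'I_n := widen_ord (leq_pred n) i.

Lemma ord_hi_proof n (i : 'I_n.-1) : i.+1 < n.
Proof. by have := ltn_ord i; lia. Qed.

Definition ord_hi n (i : 'I_n.-1) : 'I_n := Ordinal (ord_hi_proof i).

Definition framed_letter n : Type := ('I_n.-1 + 'I_n)%type.
HB.instance Definition _ n := Finite.on (framed_letter n).

Definition tl n (i : 'I_n.-1) : framed_letter n := inl i.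
Definition zl n (j : 'I_n) : framed_letter n := inr j.

Inductive framed_rel (n d : nat) :
    seq (framed_letter n) -> seq (framed_letter n) -> Prop :=
| framed_tt i :
    framed_rel d [:: tl i; tl i] [:: tl i]
| framed_tC (i j : 'I_n.-1) : (i.+1 < j) || (j.+1 < i) ->
    framed_rel d [:: tl i; tl j] [:: tl j; tl i]
| framed_ttt (i j : 'I_n.-1) : (i.+1 == j) || (j.+1 == i) ->
    framed_rel d [:: tl i; tl j; tl i] [:: tl i]
| framed_zd i :
    framed_rel d (nseq d (zl i)) [::]
| framed_zC i j :
    framed_rel d [:: zl i; zl j] [:: zl j; zl i]
| framed_tz i :
    framed_rel d [:: tl i; zl (ord_lo i)] [:: tl i; zl (ord_hi i)]
| framed_zt i :
    framed_rel d [:: zl (ord_lo i); tl i] [:: zl (ord_hi i); tl i]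
| framed_ztC i j : i != ord_lo j -> i != ord_hi j ->
    framed_rel d [:: zl i; tl j] [:: tl j; zl i]
| framed_tzkt i k :
    framed_rel d (tl i :: nseq k (zl (ord_lo i)) ++ [:: tl i]) [:: tl i].

Definition framedJones n d := presented (@framed_rel n d).
HB.instance Definition _ n d := monoid.Monoid.on (framedJones n d).

Definition gen_t n d (i : 'I_n.-1) : framedJones n d := gen _ (tl i).
Definition gen_z n d (j : 'I_n) : framedJones n d := gen _ (zl j).

(** A system of beaded arcs on a set [T] of points: the first component sends
    a point to the other end of its arc, the second one sends it to the number
    of beads on its arc.  Fixed points of the first component are points that
    belong to no arc. *)
Definition arcs (T M : Type) : Type := ((T -> T) * (T -> M))%type.

(** Glue the points [pq.1] and [pq.2] together: the arcs ending there are
    merged, their beads are added, and the two points are no longer ends of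
    arcs.  If the two points are the ends of a single arc, this arc closes up
    into a loop, which is thereby discarded. *)
Definition join (T : eqType) (M : zmodType) (s : arcs T M) (pq : T * T) :
    arcs T M :=
  let: (p, q) := pq in
  (fun x => if (x == p) || (x == q) then x
            else if s.1 x == p then s.1 q
            else if s.1 x == q then s.1 p
            else s.1 x,
   fun x => if (x == p) || (x == q) then 0%R
            else if s.1 x == p then (s.2 x + s.2 q)%R
            else if s.1 x == q then (s.2 x + s.2 p)%R
            else s.2 x).

Definition joins (T : eqType) (M : zmodType) (s : arcs T M) (l : seq (T * T)) :
    arcs T M := foldl (@join T M) s l.

Definition arcs_sum (T U M : Type) (s : arcs T M) (t : arcs U M) :
    arcs (T + U) M :=
  (fun x => match x with inl u => inl (s.1 u) | inr v => inr (t.1 v) end,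
   fun x => match x with inl u => s.2 u | inr v => t.2 v end).

(** The points [T] lie on the boundary line of a half-plane, at the abscissas
    [pos], and their arcs are drawn in that half-plane. *)
Definition noncrossing (T : finType) (pos : T -> nat) (f : T -> T) : bool :=
  [forall x, forall y,
     ~~ [&& pos x < pos y, pos y < pos (f x) & pos (f x) < pos (f y)]].

Section Sim.
Variable M : zmodType.

Definition sim T U (i : T -> U) (s : arcs T M) (t : arcs U M) :=
  (forall x, t.1 (i x) = i (s.1 x)) /\ (forall x, t.2 (i x) = s.2 x).

Lemma sim_comp T U V (i : T -> U) (j : U -> V) s t u :
  sim i s t -> sim j t u -> sim (j \o i) s u.
Proof.
by move=> [h1 h2] [k1 k2]; split=> x /=; rewrite ?k1 ?h1 ?k2 ?h2.
Qed.

Lemma sim_ext T U (i j : T -> U) s t : i =1 j -> sim i s t -> sim j s t.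
Proof. by move=> ij [h1 h2]; split=> x; rewrite -!ij. Qed.

Lemma sim_join (T U : eqType) (i : T -> U) s t p q : injective i ->
  sim i s t -> sim i (join s (p, q)) (join t (i p, i q)).
Proof.
move=> inj_i [h1 h2]; split=> x /=; rewrite !h1 ?h2 !(inj_eq inj_i) //.
by do !case: ifP => // _.
Qed.

Lemma sim_joins (T U : eqType) (i : T -> U) s t l : injective i ->
  sim i s t -> sim i (joins s l) (joins t [seq (i pq.1, i pq.2) | pq <- l]).
Proof.
move=> inj_i; elim: l s t => //= -[p q] l IHl s t st.
exact/IHl/sim_join.
Qed.

Lemma sim_inj (T U : Type) (i : T -> U) s s' t t' : injective i ->
  sim i s t -> sim i s' t' -> sim id t t' -> sim id s s'.
Proof.
move=> inj_i [h1 h2] [k1 k2] [e1 e2]; split=> x /=.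
  by apply: inj_i; rewrite -h1 -k1 e1.
by rewrite -h2 -k2 e2.
Qed.

Lemma sim_sum T U T' U' (i : T -> T') (j : U -> U') (s : arcs T M) s' t t' :
  sim i s s' -> sim j t t' ->
  sim (fun x => match x with inl u => inl (i u) | inr v => inr (j v) end)
    (arcs_sum s t) (arcs_sum s' t').
Proof.
by move=> [h1 h2] [k1 k2]; split=> -[x|x] /=; rewrite ?h1 ?k1 ?h2 ?k2.
Qed.

Lemma sim_id T (s : arcs T M) : sim id s s.
Proof. by []. Qed.

Lemma sim_id_sym T (s t : arcs T M) : sim id s t -> sim id t s.
Proof. by move=> [h1 h2]; split=> x; rewrite ?h1 ?h2. Qed.

Lemma sim_id_trans T (s t u : arcs T M) : sim id s t -> sim id t u -> sim id s u.
Proof. by move=> [h1 h2] [k1 k2]; split=> x; rewrite ?k1 ?h1 ?k2 ?h2. Qed.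

Lemma joins_suml (T U : eqType) (s : arcs T M) (t : arcs U M) l :
  sim id (arcs_sum (joins s l) t)
    (joins (arcs_sum s t) [seq (inl pq.1, inl pq.2) | pq <- l]).
Proof.
suff H s1 : sim id (arcs_sum s t) s1 -> sim id (arcs_sum (joins s l) t)
    (joins s1 [seq (inl pq.1, inl pq.2) | pq <- l]) by exact: H.
elim: l s s1 => //= -[p q] l IHl s s1 [h1 h2]; apply: IHl.
have eqE (x y : T) : ((inl x : T + U) == inl y) = (x == y) by [].
split=> -[x|x] /=; rewrite !h1 ?h2 //= !eqE; by do !case: ifP => // _.
Qed.

Lemma joins_sumr (T U : eqType) (s : arcs T M) (t : arcs U M) l :
  sim id (arcs_sum s (joins t l))
    (joins (arcs_sum s t) [seq (inr pq.1, inr pq.2) | pq <- l]).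
Proof.
suff H s1 : sim id (arcs_sum s t) s1 -> sim id (arcs_sum s (joins t l))
    (joins s1 [seq (inr pq.1, inr pq.2) | pq <- l]) by exact: H.
elim: l t s1 => //= -[p q] l IHl t s1 [h1 h2]; apply: IHl.
have eqE (x y : U) : ((inr x : T + U) == inr y) = (x == y) by [].
split=> -[x|x] /=; rewrite !h1 ?h2 //= !eqE; by do !case: ifP => // _.
Qed.

Section Good.
Variable T : finType.
Implicit Types (s : arcs T M) (l : seq (T * T)).

Definition ends l : seq T := flatten [seq [:: pq.1; pq.2] | pq <- l].

(** [s] is a system of arcs covering exactly the points outside [D]. *)
Definition good (D : pred T) s :=
  [/\ involutive s.1, forall x, (s.1 x == x) = D x
    & forall x, s.2 (s.1 x) = s.2 x].

Lemma good_join D s p q : good D s -> p != q -> ~~ D p -> ~~ D q ->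
  good (fun x => [|| x == p, x == q | D x]) (join s (p, q)).
Proof.
move=> [inv fixD bd] pq Dp Dq.
have fp : s.1 p != p by rewrite fixD.
have fq : s.1 q != q by rewrite fixD.
have canE x y : (s.1 x == y) = (x == s.1 y) by exact: inv_eq.
have inj x y : (s.1 x == s.1 y) = (x == y) by exact: (inj_eq (inv_inj inv)).
split=> x /=.
- case: (eqVneq x p) => [->|xp] /=; first by rewrite eqxx.
  case: (eqVneq x q) => [->|xq] /=; first by rewrite eqxx orbT.
  case: (eqVneq (s.1 x) p) => [xfp|xfp].
    have exp : x = s.1 p by rewrite -xfp inv.
    case: (eqVneq (s.1 q) p) => [qfp|qfp] /=.
      by move: xfp; rewrite -qfp => /eqP; rewrite inj (negPf xq).
    by rewrite (negPf fq) inv eq_sym (negPf pq) eqxx exp.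
  case: (eqVneq (s.1 x) q) => [xfq|xfq].
    have exq : x = s.1 q by rewrite -xfq inv.
    case: (eqVneq (s.1 p) q) => [pfq|pfq] /=.
      by move: xfq; rewrite -pfq => /eqP; rewrite inj (negPf xp).
    by rewrite (negPf fp) inv eqxx exq.
  by rewrite (negPf xfp) (negPf xfq) inv (negPf xp) (negPf xq).
- case: (eqVneq x p) => [->|xp] /=; first by rewrite eqxx.
  case: (eqVneq x q) => [->|xq] /=; first by rewrite eqxx.
  case: (eqVneq (s.1 x) p) => [xfp|xfp].
    have -> : x = s.1 p by rewrite -xfp inv.
    by rewrite inj eq_sym (negPf pq) -fixD inv [RHS]eq_sym (negPf fp).
  case: (eqVneq (s.1 x) q) => [xfq|xfq].
    have -> : x = s.1 q by rewrite -xfq inv.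
    by rewrite inj (negPf pq) -fixD inv [RHS]eq_sym (negPf fq).
  by rewrite fixD.
- case: (eqVneq x p) => [->|xp] /=; first by rewrite eqxx.
  case: (eqVneq x q) => [->|xq] /=; first by rewrite eqxx orbT.
  case: (eqVneq (s.1 x) p) => [xfp|xfp].
    have exp : x = s.1 p by rewrite -xfp inv.
    case: (eqVneq (s.1 q) p) => [qfp|qfp] /=.
      by move: xfp; rewrite -qfp => /eqP; rewrite inj (negPf xq).
    by rewrite (negPf fq) inv eq_sym (negPf pq) eqxx bd exp bd GRing.addrC.
  case: (eqVneq (s.1 x) q) => [xfq|xfq].
    have exq : x = s.1 q by rewrite -xfq inv.
    case: (eqVneq (s.1 p) q) => [pfq|pfq] /=.
      by move: xfq; rewrite -pfq => /eqP; rewrite inj (negPf xp).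
    by rewrite (negPf fp) inv eqxx exq !bd GRing.addrC.
  by rewrite (negPf xfp) (negPf xfq) inv (negPf xp) (negPf xq) bd.
Qed.

Lemma good_joins D s l : good D s -> uniq (ends l) ->
  {in ends l, forall x, ~~ D x} ->
  good (fun x => (x \in ends l) || D x) (joins s l).
Proof.
elim: l D s => [//|[p q] l IHl] D s gs /=.
rewrite inE negb_or => /and3P[/andP[pq pl] ql ul] Dl.
have Dp : ~~ D p by apply: Dl; rewrite !inE eqxx.
have Dq : ~~ D q by apply: Dl; rewrite !inE eqxx orbT.
have [x xl|h1 h2 h3] := IHl _ _ (good_join gs pq Dp Dq) ul.
  rewrite !negb_or Dl ?inE ?xl ?orbT // andbT.
  by apply/andP; split; [apply: contraNneq pl|apply: contraNneq ql] => <-.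
by split=> // x; rewrite h2 !inE; do !case: (_ == _); rewrite ?orbT //=;
  case: (x \in _).
Qed.

Lemma join_comm D s p q p' q' : good D s -> uniq [:: p; q; p'; q'] ->
  ~~ D p -> ~~ D q -> ~~ D p' -> ~~ D q' ->
  sim id (join (join s (p, q)) (p', q')) (join (join s (p', q')) (p, q)).
Proof.
move=> [inv fixD bd]; rewrite /= !inE !negb_or !andbT -!andbA.
case/and5P=> /eqP pq /eqP pp' /eqP pq' /eqP qp' /andP[/eqP qq' /eqP p'q'].
rewrite -!fixD => /eqP fp /eqP fq /eqP fp' /eqP fq'.
have := (inv p, inv q, inv p', inv q') => -[[[ip iq] ip'] iq'].
split=> x; have ix := inv x; rewrite /=;
  case: (x =P p) => xp /=; case: (x =P q) => xq /=;
  case: (x =P p') => xp' /=; case: (x =P q') => xq' /=;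
  case: (s.1 x =P p) => fxp /=; case: (s.1 x =P q) => fxq /=;
  case: (s.1 x =P p') => fxp' /=; case: (s.1 x =P q') => fxq' /=;
  try congruence; repeat (case: eqP => ? /=); try congruence;
  by rewrite ?GRing.addrA // GRing.addrAC.
Qed.

Lemma sim_id_joins s t l : sim id s t -> sim id (joins s l) (joins t l).
Proof.
move=> st; have := sim_joins l (@inj_id T) st.
by rewrite (_ : map _ l = l) //; elim: l => //= -[p q] l ->.
Qed.

Lemma joins_join_comm D s p q l : good D s ->
  uniq [:: p, q & ends l] -> ~~ D p -> ~~ D q ->
  {in ends l, forall x, ~~ D x} ->
  sim id (joins (join s (p, q)) l) (join (joins s l) (p, q)).
Proof.
elim: l D s => [//|[p' q'] l IHl] D s gs /= upq Dp Dq Dl.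
have Dp' : ~~ D p' by apply: Dl; rewrite inE eqxx.
have Dq' : ~~ D q' by apply: Dl; rewrite !inE eqxx orbT.
have upq' : uniq [:: p; q; p'; q'].
  by move: upq; rewrite /= !inE !negb_or; do !case: (_ != _); rewrite ?andbF.
have p'q' : p' != q' by move: upq'; rewrite /= !inE !negb_or; case: (p' != q'); rewrite ?andbF.
have st := sim_id_joins l (join_comm gs upq' Dp Dq Dp' Dq').
apply: (sim_id_trans st); apply: (IHl _ _ (good_join gs p'q' Dp' Dq')).
- by move: upq; rewrite /= !inE !negb_or => /and5P[/and4P[-> _ _ ->] /and3P[_ _ ->] _ _ ->].
- by move: upq'; rewrite /= !inE !negb_or Dp; case/and4P=> /and3P[_ -> ->].
- by move: upq'; rewrite /= !inE !negb_or Dq; case/and4P=> _ /andP[-> ->].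
- move=> x xl; rewrite !negb_or Dl ?inE ?xl ?orbT // andbT.
  case/and5P: upq => _ _ p'l q'l _; rewrite inE negb_or in p'l.
  case/andP: p'l => _ p'l.
  by apply/andP; split; [apply: contraNneq p'l|apply: contraNneq q'l] => <-.
Qed.

Lemma joins_comm D s l1 l2 : good D s -> uniq (ends (l1 ++ l2)) ->
  {in ends (l1 ++ l2), forall x, ~~ D x} ->
  sim id (joins (joins s l1) l2) (joins (joins s l2) l1).
Proof.
elim: l1 D s => [//|[p q] l1 IHl1] D s gs /= upq Dl.
have Dp : ~~ D p by apply: Dl; rewrite inE eqxx.
have Dq : ~~ D q by apply: Dl; rewrite !inE eqxx orbT.
have ecat : ends (l1 ++ l2) = ends l1 ++ ends l2.
  by rewrite /ends map_cat flatten_cat.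
move: (upq); rewrite inE negb_or => /and3P[/andP[pq pl] ql ul].
have st := IHl1 _ _ (good_join gs pq Dp Dq) ul.
apply: (sim_id_trans (st _)).
  move=> x xl; rewrite !negb_or Dl ?inE ?xl ?orbT // andbT.
  by apply/andP; split; [apply: contraNneq pl|apply: contraNneq ql] => <-.
apply: sim_id_joins; apply: (joins_join_comm gs) => //.
  move: pl ql ul; rewrite -/(ends _) ecat !mem_cat !negb_or cat_uniq.
  move=> /andP[_ pl] /andP[_ ql] /and3P[_ _ ul].
  by rewrite /= inE negb_or pq pl ql ul.
move=> x xl; apply: Dl; change (x \in [:: p, q & ends (l1 ++ l2)]).
by rewrite ecat !inE mem_cat xl !orbT.
Qed.

Lemma noncrossing_join D (pos : T -> nat) s p q : injective pos ->
  good D s -> ~~ D p -> ~~ D q -> pos p < pos q ->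
  (forall x, pos p < pos x < pos q -> D x) ->
  noncrossing pos s.1 -> noncrossing pos (join s (p, q)).1.
Proof.
move=> inj_pos [inv fixD bd] Dp Dq pq Dpq /'forall_forallP nc.
have fp : s.1 p <> p by apply/eqP; rewrite fixD.
have fq : s.1 q <> q by apply/eqP; rewrite fixD.
have out x : s.1 x <> x -> pos x <= pos p \/ pos q <= pos x.
  move=> /eqP; rewrite fixD => Dx.
  have [/Dpq|] := boolP (pos p < pos x < pos q); first by rewrite (negPf Dx).
  by lia.
have posE x y : x <> y -> pos x <> pos y by move=> xy /inj_pos.
have cross x y u v : s.1 x = u -> s.1 y = v ->
    ~ (pos x < pos y /\ pos y < pos u /\ pos u < pos v).
  by move=> <- <- [h1 [h2 h3]]; have := nc x y; rewrite h1 h2 h3.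
have side a b y v : s.1 a = b -> s.1 y = v -> a <> y -> a <> v ->
    b <> y -> b <> v -> (pos y < pos a < pos v) = (pos y < pos b < pos v).
  move=> ab yv; have ba : s.1 b = a by rewrite -ab inv.
  move=> /posE a1 /posE a2 /posE b1 /posE b2.
  by move: (cross _ _ _ _ ab yv) (cross _ _ _ _ yv ab) (cross _ _ _ _ ba yv)
    (cross _ _ _ _ yv ba); clear -a1 a2 b1 b2; lia.
(* an arc [{x, u}] obtained by joining [{x, p}] and [{q, u}], and an old arc *)
have key x u y v : s.1 x = p -> s.1 u = q -> s.1 y = v ->
    x <> y -> x <> v -> u <> y -> u <> v -> y <> p -> y <> q -> v <> p ->
    v <> q -> y <> v ->
    (pos y < pos x < pos v) = (pos y < pos u < pos v).
  move=> xp uq yv a1 a2 a3 a4 c1 c2 c3 c4 yv'.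
  rewrite (side _ _ _ _ xp yv) ?(side _ _ _ _ uq yv) //; try exact: not_eq_sym.
  have oy := out y; have ov := out v; rewrite -{1}yv inv yv in oy ov.
  move: (oy (not_eq_sym yv')) (ov yv') pq (posE _ _ c1) (posE _ _ c2).
  by move: (posE _ _ c3) (posE _ _ c4); clear; lia.
apply/'forall_forallP => x y; apply/negP => /and3P[].
have inj u v : s.1 u = s.1 v -> u = v by exact: (inv_inj inv).
have ip := inv p; have iq := inv q; have ix := inv x; have iy := inv y.
rewrite /=; case: (x =P p) => xp /=; first by clear; lia.
case: (x =P q) => xq /=; first by clear; lia.
case: (y =P p) => yp /=; first by clear; lia.
case: (y =P q) => yq /=; first by clear; lia.
have npq : p <> q by move=> e; move: pq; rewrite e ltnn.
case: (s.1 x =P p) => xfp; last case: (s.1 x =P q) => xfq;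
  (case: (s.1 y =P p) => yfp; last case: (s.1 y =P q) => yfq) => h1 h2 h3.
all: try (have exy : x = y by apply: inj; congruence); try (by subst y; lia).
- have e : s.1 q = y by congruence.
  by move: h2; rewrite e ltnn.
- have := key x (s.1 q) y (s.1 y) xfp iq erefl.
  have n1 : x <> s.1 y by congruence.
  have n2 : s.1 q <> y by congruence.
  have n3 : s.1 q <> s.1 y by move=> /inj; congruence.
  have n4 : y <> s.1 y by move=> e; move: h1 h2 h3; rewrite -e; lia.
  have n5 : x <> y by move=> e; move: h1; rewrite e ltnn.
  move=> K; have {}K := K n5 n1 n2 n3 yp yq yfp yfq n4.
  by move: K h1 h2 h3; clear; lia.
- have e : s.1 p = y by congruence.
  by move: h2; rewrite e ltnn.
- have := key (s.1 p) x y (s.1 y) ip xfq erefl.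
  have n1 : x <> s.1 y by congruence.
  have n2 : s.1 p <> y by congruence.
  have n3 : s.1 p <> s.1 y by move=> /inj; congruence.
  have n4 : y <> s.1 y by move=> e; move: h1 h2 h3; rewrite -e; lia.
  have n5 : x <> y by move=> e; move: h1; rewrite e ltnn.
  move=> K; have {}K := K n2 n3 n5 n1 yp yq yfp yfq n4.
  by move: K h1 h2 h3; clear; lia.
- have := key y (s.1 q) x (s.1 x) yfp iq erefl.
  have n1 : y <> s.1 x by congruence.
  have n2 : s.1 q <> x by congruence.
  have n3 : s.1 q <> s.1 x by move=> /inj; congruence.
  have n4 : x <> s.1 x by move=> e; move: h1 h2; rewrite -e; lia.
  have n5 : y <> x by move=> e; move: h1; rewrite e ltnn.
  move=> K; have {}K := K n5 n1 n2 n3 xp xq xfp xfq n4.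
  by move: K h1 h2 h3; clear; lia.
- have := key (s.1 p) y x (s.1 x) ip yfq erefl.
  have n1 : y <> s.1 x by congruence.
  have n2 : s.1 p <> x by congruence.
  have n3 : s.1 p <> s.1 x by move=> /inj; congruence.
  have n4 : x <> s.1 x by move=> e; move: h1 h2; rewrite -e; lia.
  have n5 : y <> x by move=> e; move: h1; rewrite e ltnn.
  move=> K; have {}K := K n2 n3 n5 n1 xp xq xfp xfq n4.
  by move: K h1 h2 h3; clear; lia.
- by apply: (cross x y _ _ erefl erefl).
Qed.


End Good.
End Sim.

(** [inl i] is the [i]-th point of the top line, [inr i] the [i]-th point of
    the bottom line. *)
Notation endpoint n := ('I_n + 'I_n)%type.

(** The rank of a point when one reads the top line from left to right, then
    the bottom line from right to left: cut open at its left end, the boundary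
    of the strip between the two lines becomes a line. *)
Definition boundary n (x : endpoint n) : nat :=
  match x with inl i => i | inr i => (n + n).-1 - i end.

(** Integers modulo [d]; the index is [d] itself when [d] is positive. *)
Notation residue d := ('I_d.-1.+1).

(** A pair of the function exchanging the two ends of each arc, and of the
    function sending an endpoint to the number of beads on its arc. *)
Definition is_abacus n d
    (s : {ffun endpoint n -> endpoint n} * {ffun endpoint n -> residue d}) :=
  [&& [forall x, s.1 (s.1 x) == x], [forall x, s.1 x != x],
      noncrossing (@boundary n) s.1 & [forall x, s.2 (s.1 x) == s.2 x]].

Record abacusJones n d := Abacus {
  abacus_val :>
    {ffun endpoint n -> endpoint n} * {ffun endpoint n -> residue d};
  _ : is_abacus abacus_val
}.

HB.instance Definition _ n d := [isSub for @abacus_val n d].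
HB.instance Definition _ n d := [Finite of abacusJones n d by <:].

Section Abacus.
Variables n d : nat.
Local Notation E := (endpoint n).
Local Notation M := (residue d).
Local Notation abacus := (abacusJones n d).

Definition arcs_of (a : abacus) : arcs E M := (a.1 : E -> E, a.2 : E -> M).

Lemma abacus_good a : good pred0 (arcs_of a).
Proof.
have /and4P[/forallP h1 /forallP h2 _ /forallP h3] := valP a.
by split=> x /=; [exact/eqP/h1|exact: negPf (h2 x)|exact/eqP/h3].
Qed.

Lemma abacus_noncrossing (a : abacus) : noncrossing (@boundary n) a.1.
Proof. by have /and4P[] := valP a. Qed.

Lemma abacus_proof (s : arcs E M) : good pred0 s ->
  noncrossing (@boundary n) s.1 ->
  is_abacus ([ffun x => s.1 x], [ffun x => s.2 x]).
Proof.
move=> [inv fix0 bd] /'forall_forallP nc.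
apply/and4P; split; first by apply/forallP=> x; rewrite /= !ffunE inv.
- by apply/forallP=> x; rewrite /= ffunE; have /negbT := fix0 x.
- by apply/'forall_forallP=> x y; rewrite /= !ffunE.
- by apply/forallP=> x; rewrite /= !ffunE bd.
Qed.

Definition mk_abacus s gs nc : abacus := Abacus (@abacus_proof s gs nc).

Lemma arcs_ofK s gs nc : sim id (arcs_of (@mk_abacus s gs nc)) s.
Proof. by split=> x /=; rewrite ffunE. Qed.

Lemma abacus_eq (a b : abacus) : sim id (arcs_of a) (arcs_of b) -> a = b.
Proof.
move=> [h1 h2]; apply: val_inj; rewrite [val a]surjective_pairing.
rewrite [val b]surjective_pairing; congr pair; apply/ffunP=> x.
  exact/esym/h1.
exact/esym/h2.
Qed.

(** The bottom points of the upper diagram and the top points of the lower one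
    that have to be identified when the diagrams are concatenated. *)
Definition middle : seq ((E + E) * (E + E)) :=
  [seq (inl (inr i), inr (inl i)) | i <- enum 'I_n].

Definition stack (a b : abacus) : arcs (E + E) M :=
  joins (arcs_sum (arcs_of a) (arcs_of b)) middle.

(** The endpoints of the concatenated diagram among those of the factors. *)
Definition outer (x : E) : E + E :=
  match x with inl i => inl (inl i) | inr i => inr (inr i) end.

Definition outer_inv (x : E + E) : E :=
  match x with inl x => x | inr x => x end.

Definition mul_arcs (a b : abacus) : arcs E M :=
  (fun x => outer_inv ((stack a b).1 (outer x)),
   fun x => (stack a b).2 (outer x)).

Definition mids (l : seq 'I_n) : seq ((E + E) * (E + E)) :=
  [seq (inl (inr i), inr (inl i)) | i <- l].

Definition is_mid (l : seq 'I_n) (x : E + E) : bool :=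
  match x with
  | inl (inr i) | inr (inl i) => i \in l
  | _ => false
  end.

Lemma mem_ends_mids l x : (x \in ends (mids l)) = is_mid l x.
Proof.
elim: l => [|i l IHl]; first by case: x => -[].
rewrite /= !inE -/(ends _) {}IHl.
by case: x => -[j|j] //=; rewrite ?inE // orbF.
Qed.

Lemma uniq_ends_mids l : uniq l -> uniq (ends (mids l)).
Proof.
elim: l => [//|i l IHl] /= /andP[il /IHl ul].
by rewrite !inE -/(ends _) !mem_ends_mids /= il ul.
Qed.

Lemma good_sum (T U : finType) D D' (s : arcs T M) (t : arcs U M) :
  good D s -> good D' t ->
  good (fun x => match x with inl u => D u | inr v => D' v end) (arcs_sum s t).
Proof.
move=> [h1 h2 h3] [k1 k2 k3].
by split=> -[x|x] //=; rewrite ?h1 ?k1 ?h3 ?k3 // -?h2 -?k2.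
Qed.

Lemma good_sum_abacus a b :
  good pred0 (arcs_sum (arcs_of a) (arcs_of b)).
Proof.
have [h1 h2 h3] := good_sum (abacus_good a) (abacus_good b).
by split=> // x; rewrite h2; case: x.
Qed.

Lemma good_mids a b l : uniq l ->
  good (is_mid l) (joins (arcs_sum (arcs_of a) (arcs_of b)) (mids l)).
Proof.
move=> ul.
have [//|h1 h2 h3] := good_joins (good_sum_abacus a b) (uniq_ends_mids ul).
by split=> // x; rewrite h2 mem_ends_mids orbF.
Qed.

Lemma good_stack a b : good (is_mid (enum 'I_n)) (stack a b).
Proof. exact/good_mids/enum_uniq. Qed.

Lemma outer_inj : injective outer.
Proof. by move=> [i|i] [j|j] //= [->]. Qed.

Lemma outerK x : ~~ is_mid (enum 'I_n) x -> outer (outer_inv x) = x.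
Proof. by case: x => -[i|i] //=; rewrite mem_enum. Qed.

Lemma sim_mul_arcs a b : sim outer (mul_arcs a b) (stack a b).
Proof.
have [inv fixD _] := good_stack a b.
split=> x //=; rewrite outerK // -fixD (inj_eq (inv_inj inv)) fixD.
by case: x.
Qed.

Lemma good_mul_arcs a b : good pred0 (mul_arcs a b).
Proof.
have [inv fixD bd] := good_stack a b; have [h1 h2] := sim_mul_arcs a b.
split=> x; first by apply: outer_inj; rewrite -!h1 inv.
  by rewrite -(inj_eq outer_inj) -h1 fixD; case: x.
by rewrite -!h2 -h1 bd.
Qed.

Lemma boundary_lt (x : E) : boundary x < n + n.
Proof. by case: x => i /=; have := ltn_ord i; lia. Qed.

Lemma boundary_inj : injective (@boundary n).
Proof.
move=> [i|i] [j|j] /=; have := ltn_ord i; have := ltn_ord j => ? ? e.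
- by congr inl; apply: ord_inj.
- by lia.
- by lia.
- by congr inr; apply: ord_inj; lia.
Qed.

Definition boundary2 (x : E + E) : nat :=
  match x with inl x => boundary x | inr x => n + n + boundary x end.

Lemma boundary2_inj : injective boundary2.
Proof.
move=> [x|x] [y|y] /=; have := boundary_lt x; have := boundary_lt y => ? ? e.
- by congr inl; apply: boundary_inj.
- by lia.
- by lia.
- by congr inr; apply: boundary_inj; lia.
Qed.

Lemma noncrossing_sum a b :
  noncrossing boundary2 (arcs_sum (arcs_of a) (arcs_of b)).1.
Proof.
have /'forall_forallP nca := abacus_noncrossing a.
have /'forall_forallP ncb := abacus_noncrossing b.
apply/'forall_forallP => -[x|x] [y|y] /=.
- exact: nca.
- by have := boundary_lt (a.1 x); lia.
- by have := boundary_lt y; have := boundary_lt (a.1 y); lia.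
- by have := ncb x y; lia.
Qed.

Lemma noncrossing_mids a b k : k <= n -> noncrossing boundary2
  (joins (arcs_sum (arcs_of a) (arcs_of b)) (mids (take k (enum 'I_n)))).1.
Proof.
elim: k => [|k IHk] kn; first by rewrite take0; exact: noncrossing_sum.
pose i := Ordinal kn.
have ei : nth i (enum 'I_n) k = i by exact: (nth_ord_enum i i).
rewrite (take_nth i) ?size_enum_ord // ei /mids map_rcons -cats1.
rewrite /joins foldl_cat -/(joins _ _) /=.
have memk j : (j \in take k (enum 'I_n)) = (j < k).
  by rewrite in_take ?mem_enum // index_enum_ord.
apply: (@noncrossing_join _ _ (is_mid (take k (enum 'I_n)))).
- exact: boundary2_inj.
- exact/good_mids/take_uniq/enum_uniq.
- by rewrite /= memk ltnn.
- by rewrite /= memk ltnn.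
- by rewrite /=; have := ltn_ord i; lia.
- move=> [[j|j]|[j|j]] /=; rewrite ?memk; have := ltn_ord j; lia.
- by apply: IHk; exact: ltnW.
Qed.

Lemma noncrossing_mul_arcs a b : noncrossing (@boundary n) (mul_arcs a b).1.
Proof.
have := noncrossing_mids a b (leqnn n).
rewrite take_oversize ?size_enum_ord // => /'forall_forallP nc.
have [h1 _] := sim_mul_arcs a b.
have mono x y : (boundary2 (outer x) < boundary2 (outer y))
              = (boundary x < boundary y).
  by case: x y => i [] j /=; have := ltn_ord i; have := ltn_ord j; lia.
by apply/'forall_forallP => x y; rewrite -!mono -!h1; exact: nc.
Qed.

(** [abacus_mul a b] is [a] placed above [b]. *)
Definition abacus_mul (a b : abacus) : abacus :=
  mk_abacus (good_mul_arcs a b) (noncrossing_mul_arcs a b).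

Lemma sim_mul a b : sim outer (arcs_of (abacus_mul a b)) (stack a b).
Proof.
exact: (sim_comp (arcs_ofK (good_mul_arcs a b) (noncrossing_mul_arcs a b))
  (sim_mul_arcs a b)).
Qed.

Definition strands (f : 'I_n -> M) : arcs E M :=
  (fun x => match x with inl i => inr i | inr i => inl i end,
   fun x => match x with inl i | inr i => f i end).

Lemma good_strands f : good pred0 (strands f).
Proof. by split=> -[]. Qed.

Lemma noncrossing_strands f : noncrossing (@boundary n) (strands f).1.
Proof.
apply/'forall_forallP => -[i|i] [j|j] /=.
all: have := ltn_ord i; have := ltn_ord j; lia.
Qed.

Definition abacus_strands f : abacus :=
  mk_abacus (good_strands f) (noncrossing_strands f).

Definition abacus_one : abacus := abacus_strands (fun=> 0%R).

Lemma abacus_mulA : associative abacus_mul.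
Proof.
move=> a b c.
pose s := arcs_sum (arcs_of a) (arcs_sum (arcs_of b) (arcs_of c)).
pose lab : seq ((E + (E + E)) * (E + (E + E))) :=
  [seq (inl (inr i), inr (inl (inl i))) | i <- enum 'I_n].
pose lbc : seq ((E + (E + E)) * (E + (E + E))) :=
  [seq (inr (inl (inr i)), inr (inr (inl i))) | i <- enum 'I_n].
pose out3 (x : E) : E + (E + E) :=
  match x with inl i => inl (inl i) | inr i => inr (inr (inr i)) end.
have out3_inj : injective out3 by move=> [i|i] [j|j] //= [->].
have simr : sim out3 (arcs_of (abacus_mul a (abacus_mul b c)))
    (joins (joins s lbc) lab).
  have h1 := sim_comp (sim_sum (sim_id (arcs_of a)) (sim_mul b c))
    (joins_sumr (arcs_of a) (arcs_sum (arcs_of b) (arcs_of c)) middle).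
  have h2 := sim_joins middle _ h1.
  have {h1 h2}h := sim_comp (sim_mul a (abacus_mul b c)) (h2 _).
  move: h; rewrite /lab /lbc /middle; move: (enum 'I_n) => l.
  rewrite -!map_comp => h.
  apply: (sim_ext _ (h _)) => [[x|x]|[x|x] [y|y]] //= [] => [|/outer_inj] -> //.
have siml : sim out3 (arcs_of (abacus_mul (abacus_mul a b) c))
    (joins (joins s lab) lbc).
  pose al (x : E + E + E) : E + (E + E) :=
    match x with
    | inl (inl x) => inl x | inl (inr x) => inr (inl x) | inr x => inr (inr x)
    end.
  have al_inj : injective al by move=> [[x|x]|x] [[y|y]|y] //= [->].
  have al_sim : sim al
      (arcs_sum (arcs_sum (arcs_of a) (arcs_of b)) (arcs_of c)) s.
    by split=> -[[x|x]|x].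
  have h1 := sim_comp (sim_sum (sim_mul a b) (sim_id (arcs_of c)))
    (sim_comp (joins_suml (arcs_sum (arcs_of a) (arcs_of b)) (arcs_of c) middle)
       (sim_joins _ al_inj al_sim)).
  have h2 := sim_joins middle _ h1.
  have {h1 h2}h := sim_comp (sim_mul (abacus_mul a b) c) (h2 _).
  move: h; rewrite /lab /lbc /middle; move: (enum 'I_n) => l.
  rewrite -!map_comp => h.
  apply: (sim_ext _ (h _)) => [[x|x]|] //.
  refine (inj_comp (inj_comp al_inj (@inj_id _)) _) => [[x|x] [y|y]] //=.
    by move=> [/outer_inj ->].
  by move=> [->].
apply: abacus_eq; apply: (sim_inj out3_inj simr siml).
have gs : good pred0 s.
  have [h1 h2 h3] := good_sum (abacus_good a) (good_sum_abacus b c).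
  by split=> // x; rewrite h2; case: x.
apply: (joins_comm gs) => //.
have endsE l : ends
    ([seq (inr (inl (inr i)), inr (inr (inl i))) | i <- l]
      : seq ((E + (E + E)) * (E + (E + E)))) = 
    [seq inr x | x <- ends (mids l)].
  by elim: l => //= i l IHl; congr [:: _, _ & _]; exact: IHl.
rewrite /ends map_cat flatten_cat -!/(ends _) endsE cat_uniq.
have e2 l x : (x \in ends ([seq (inl (inr i), inr (inl (inl i))) | i <- l]
      : seq ((E + (E + E)) * (E + (E + E))))) =
    match x with inl (inr i) | inr (inl (inl i)) => i \in l | _ => false end.
  elim: l => [|i l IHl]; first by case: x => [[]|[[]|[]]].
  rewrite /= !inE -/(ends _) {}IHl.
  by case: x => [[]|[[]|[]]] j //=; rewrite ?inE ?orbF.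
apply/and3P; split.
- by rewrite map_inj_uniq ?uniq_ends_mids ?enum_uniq // => x y [].
- apply/hasPn => x; rewrite e2 => xl; apply/mapP => -[y].
  by rewrite mem_ends_mids; case: x xl => [[]|[[]|[]]] // i _; case: y => [] [].
- move: (enum_uniq 'I_n); rewrite /lab; elim: (enum 'I_n) => //= i l IHl /andP[il /IHl ul].
  by rewrite !inE -!/(ends _) !e2 /= il; exact: ul.
Qed.

Definition outer_top (l : seq 'I_n) (x : E) : E + E :=
  match x with
  | inl i => if i \in l then inl (inl i) else inr (inl i)
  | inr i => inr (inr i)
  end.

Lemma abacus_mul1 : left_id abacus_one abacus_mul.
Proof.
move=> a; have [inv fix0 bd] := abacus_good a.
pose P (l : seq 'I_n) (s : arcs (E + E) M) := sim (outer_top l) (arcs_of a) s /\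
  forall i, i \notin l -> [/\ s.1 (inl (inl i)) = inl (inr i),
    s.1 (inl (inr i)) = inl (inl i), s.2 (inl (inl i)) = 0%R
    & s.2 (inl (inr i)) = 0%R].
have step i l s : i \notin l -> P l s ->
    P (i :: l) (join s (inl (inr i), inr (inl i))).
  move=> il [[h1 h2] h]; have [k1 k2 k3 k4] := h i il.
  have ei : inr (inl i) = outer_top l (inl i) by rewrite /= (negPf il).
  have ot_inj : injective (outer_top l).
    by move=> [j|j] [k|k] /=; do ?case: ifP => //; move=> *; congruence.
  have otE x y : (outer_top l x == outer_top l y) = (x == y) by exact: (inj_eq ot_inj).
  have nei x : outer_top l x != inl (inr i) by case: x => //= j; case: ifP.
  have otS x : x != inl i -> outer_top (i :: l) x = outer_top l x.
    by case: x => //= j ji; rewrite inE (negPf (ji : j != i)).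
  have oti : outer_top (i :: l) (inl i) = inl (inl i) by rewrite /= mem_head.
  split; last first.
    move=> j; rewrite inE negb_or => /andP[ji jl]; have [m1 m2 m3 m4] := h j jl.
    by rewrite /= m1 m2 m3 m4 !(inj_eq (@inl_inj _ _)) !(inj_eq (@inr_inj _ _))
      (negPf ji); split.
  split=> x; have [->|xi] := eqVneq x (inl i).
  - rewrite oti otS; last exact: negbT (fix0 (inl i)).
    by rewrite /= k1 eqxx -h1 -ei.
  - rewrite otS // /= (negPf (nei x)) h1 ei !otE (negPf xi) (negPf (nei _)).
    case: eqVneq => [e|ne]; first by move: e => /= ->; rewrite oti.
    exact/esym/otS.
  - by rewrite oti /= k1 eqxx k3 GRing.add0r ei h2.
  - rewrite otS // /= (negPf (nei x)) h1 ei !otE (negPf xi) (negPf (nei _)).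
    rewrite k4 GRing.addr0 h2.
    by case: ifP.
have P0 : P [::] (arcs_sum (arcs_of abacus_one) (arcs_of a)).
  have ot0 y : outer_top [::] y = inr y by case: y.
  by split; [split=> x; rewrite !ot0|move=> i _; rewrite /= !ffunE].
have Pl l l0 s : P l0 s -> uniq l -> {in l, forall i, i \notin l0} ->
    P (catrev l l0) (joins s (mids l)).
  elim: l l0 s => //= i l IHl l0 s Ps /andP[il ul] ll0.
  apply: IHl => //; first by apply: step => //; apply: ll0; exact: mem_head.
  move=> j jl; rewrite inE negb_or ll0 ?inE ?jl ?orbT // andbT.
  by apply: contraNneq il => <-.
have [st _] := Pl _ _ _ P0 (enum_uniq 'I_n) (fun _ _ => isT).
apply: abacus_eq; apply: (sim_inj outer_inj (sim_mul _ _) _ (sim_id _)).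
apply: sim_ext st => -[i|i] //=.
by rewrite catrevE cats0 mem_rev mem_enum.
Qed.

Definition outer_bot (l : seq 'I_n) (x : E) : E + E :=
  match x with
  | inl i => inl (inl i)
  | inr i => if i \in l then inr (inr i) else inl (inr i)
  end.

Lemma abacus_mulr1 : right_id abacus_one abacus_mul.
Proof.
move=> a; have [inv fix0 bd] := abacus_good a.
pose P (l : seq 'I_n) (s : arcs (E + E) M) := sim (outer_bot l) (arcs_of a) s /\
  forall i, i \notin l -> [/\ s.1 (inr (inl i)) = inr (inr i),
    s.1 (inr (inr i)) = inr (inl i), s.2 (inr (inl i)) = 0%R
    & s.2 (inr (inr i)) = 0%R].
have step i l s : i \notin l -> P l s ->
    P (i :: l) (join s (inl (inr i), inr (inl i))).
  move=> il [[h1 h2] h]; have [k1 k2 k3 k4] := h i il.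
  have ei : inl (inr i) = outer_bot l (inr i) by rewrite /= (negPf il).
  have ot_inj : injective (outer_bot l).
    by move=> [j|j] [k|k] /=; do ?case: ifP => //; move=> *; congruence.
  have otE x y : (outer_bot l x == outer_bot l y) = (x == y) by exact: (inj_eq ot_inj).
  have nei x : outer_bot l x != inr (inl i) by case: x => //= j; case: ifP.
  have otS x : x != inr i -> outer_bot (i :: l) x = outer_bot l x.
    by case: x => //= j ji; rewrite inE (negPf (ji : j != i)).
  have oti : outer_bot (i :: l) (inr i) = inr (inr i) by rewrite /= mem_head.
  split; last first.
    move=> j; rewrite inE negb_or => /andP[ji jl]; have [m1 m2 m3 m4] := h j jl.
    by rewrite /= m1 m2 m3 m4 !(inj_eq (@inr_inj _ _)) !(inj_eq (@inl_inj _ _))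
      (negPf ji); split.
  split=> x; have [->|xi] := eqVneq x (inr i).
  - rewrite oti otS; last exact: negbT (fix0 (inr i)).
    by rewrite /= k2 /= eqxx -h1 -ei.
  - rewrite otS // /= (negPf (nei x)) h1 ei !otE (negPf xi) (negPf (nei _)).
    case: eqVneq => [e|ne]; first by move: e => /= ->; rewrite oti.
    exact/esym/otS.
  - by rewrite oti /= k2 /= eqxx k4 GRing.add0r ei h2.
  - rewrite otS // /= (negPf (nei x)) h1 ei !otE (negPf xi) (negPf (nei _)).
    rewrite k3 GRing.addr0 h2.
    by case: ifP.
have P0 : P [::] (arcs_sum (arcs_of a) (arcs_of abacus_one)).
  have ot0 y : outer_bot [::] y = inl y by case: y.
  by split; [split=> x; rewrite !ot0|move=> i _; rewrite /= !ffunE].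
have Pl l l0 s : P l0 s -> uniq l -> {in l, forall i, i \notin l0} ->
    P (catrev l l0) (joins s (mids l)).
  elim: l l0 s => //= i l IHl l0 s Ps /andP[il ul] ll0.
  apply: IHl => //; first by apply: step => //; apply: ll0; exact: mem_head.
  move=> j jl; rewrite inE negb_or ll0 ?inE ?jl ?orbT // andbT.
  by apply: contraNneq il => <-.
have [st _] := Pl _ _ _ P0 (enum_uniq 'I_n) (fun _ _ => isT).
apply: abacus_eq; apply: (sim_inj outer_inj (sim_mul _ _) _ (sim_id _)).
apply: sim_ext st => -[i|i] //=.
by rewrite catrevE cats0 mem_rev mem_enum.
Qed.

HB.instance Definition _ :=
  isMonoid.Build (abacusJones n d) abacus_mulA abacus_mul1 abacus_mulr1.

Definition hook_arcs (i : 'I_n.-1) : arcs E M :=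
  (fun x => match x with
     | inl k => if k == ord_lo i then inl (ord_hi i)
                else if k == ord_hi i then inl (ord_lo i) else inr k
     | inr k => if k == ord_lo i then inr (ord_hi i)
                else if k == ord_hi i then inr (ord_lo i) else inl k
     end,
   fun=> 0%R).

Lemma good_hook i : good pred0 (hook_arcs i).
Proof.
have ne : (ord_hi i == ord_lo i) = false by rewrite -val_eqE /=; lia.
split=> //= -[k|k] /=; (case: (eqVneq k (ord_lo i)) => [->|k1];
  [|case: (eqVneq k (ord_hi i)) => [->|k2]]) => //=;
  rewrite ?ne ?eqxx ?(negPf k1) ?(negPf k2) //.
all: by apply/negP => /eqP [] /eqP; rewrite 1?eq_sym; lia.
Qed.

Lemma noncrossing_hook i : noncrossing (@boundary n) (hook_arcs i).1.
Proof.
apply/'forall_forallP => -[j|j] [k|k] /=; rewrite -!val_eqE /=.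
all: have := ltn_ord i; have := ltn_ord j; have := ltn_ord k.
all: do !(case: eqP => ? /=); lia.
Qed.

Definition abacus_t (i : 'I_n.-1) : abacus :=
  mk_abacus (good_hook i) (noncrossing_hook i).

(** When [d = 1], [inZp 1] is [0] and this is the identity diagram. *)
Definition abacus_o (j : 'I_n) : abacus :=
  abacus_strands (fun k => if k == j then inZp 1 else 0%R).

End Abacus.

(** The division is exact: see [catalanE]. *)
Definition catalan (n : nat) : nat := 'C(n.*2, n) %/ n.+1.

Lemma catalanE n : n.+1 * catalan n = 'C(n.*2, n).
Proof.
rewrite /catalan mulnC divnK // -(@Gauss_dvdr _ n) ?coprimeSn //.
have := mul_bin_left n.*2 n; rewrite -addnn addnK => <-.
exact: dvdn_mulr.
Qed.

(* Main.v *)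
Require Import Defs.
From HB Require Import structures.
From mathcomp Require Import all_boot all_algebra zify.
From mathcomp Require Import boolp classical_sets functions cardinality.

(* Stacking [t_i] below a diagram joins the bottom points [i] and [i + 1] and
   creates a hook there; checking the relations on this description gives the
   morphism. For the words in the [t_i], the relations suffice to reach a Jones
   normal form, a product of descents [t_p ... t_k] with increasing first and
   last letters. Multiplying a diagram by [t_p ... t_k] inserts a hook at [k]
   and shifts the strands to its right, so [k] is the last hook of the diagram
   of a normal form, and removing it shows that every bead-free diagram comes
   from exactly one normal form. Normal forms are counted by ballot numbers,
   hence there are [catalan n] of them. Finally the [z_i] act by adding beads
   to arcs, and the relations allow beads to slide along arcs, so that an
   element is determined by a normal form and one residue per arc. *)

(** The product glues the middle points one after the other, which is only manageable when the right
    factor is a generator; general products are reached by induction on words, letters being added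
    on the right. Injectivity requires no rewriting of words that contain beads. Two words in the
    [t_i] with the same diagram have the same normal form, hence are equal in the framed monoid
    ([tprod_eq]), so from then on one computes in that monoid by looking at diagrams. The delicate
    point is a bead caught between a word in the [t_i] and a further [t_j]. Either its arc has an
    end away from [t_j], and the bead leaves through that end; or [t_j] closes its arc into a loop,
    and then the word can be rewritten so as to end with [t_j], after which the relation
    [t_i z_i^k t_i = t_i] discards the bead. The framed monoid is never counted directly: its
    cardinality comes from the bijection with diagrams, and normal words serve to count the
    bead-free diagrams. *)

Set Implicit Arguments.
Unset Strict Implicit.
Unset Printing Implicit Defensive.

(** * Right multiplication by the generators *)

Section HookJoin.
Variables (T : finType) (M : zmodType).
Implicit Types (s t : arcs T M) (p q r x y : T) (b : T -> M).

(* The effect on [s] of gluing [t_i] below, when [p] and [q] are the bottom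
   points [i] and [i + 1]. *)
Definition hook_join s p q : arcs T M :=
  (fun x => if x == p then q else if x == q then p else (join s (p, q)).1 x,
   (join s (p, q)).2).

(** [b] counts beads dropped at points, so an arc receives those dropped at both of its ends. *)
Definition add_beads s b : arcs T M :=
  (s.1, fun x => (s.2 x + b x + b (s.1 x))%R).

Lemma sim_hook_join s t p q :
  sim id s t -> sim id (hook_join s p q) (hook_join t p q).
Proof. by move=> [e1 e2]; split=> x; rewrite /= !e1 ?e2. Qed.

Lemma sim_add_beads s t b b' : sim id s t -> b =1 b' ->
  sim id (add_beads s b) (add_beads t b').
Proof. by move=> [e1 e2] eb; split=> x; rewrite /= e1 ?e2 ?eb. Qed.

Lemma add_beads0 s b : (forall x, b x = 0%R) -> sim id (add_beads s b) s.
Proof. by move=> b0; split=> // x; rewrite /= !b0 !GRing.addr0. Qed.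

Lemma add_beadsD s b b' b'' : (forall x, b'' x = b x + b' x)%R ->
  sim id (add_beads (add_beads s b) b') (add_beads s b'').
Proof.
move=> bD; split=> // x; rewrite /= !bD -!GRing.addrA; congr (_ + (_ + _))%R.
by rewrite GRing.addrCA.
Qed.

Lemma add_beadsC s b b' :
  sim id (add_beads (add_beads s b) b') (add_beads (add_beads s b') b).
Proof.
split=> // x; rewrite /= -!GRing.addrA; congr (_ + _)%R.
by rewrite GRing.addrA GRing.addrC -GRing.addrA.
Qed.

Lemma hook_joinC s p q : good pred0 s -> p <> q ->
  sim id (hook_join s p q) (hook_join s q p).
Proof.
move=> [inv _ bd] pq; have ip := inv p; have iq := inv q.
split=> x; have ix := inv x; rewrite /=;
  case: (x =P p) => xp /=; case: (x =P q) => xq /=;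
  case: (s.1 x =P p) => fxp /=; case: (s.1 x =P q) => fxq /=; congruence.
Qed.

(* Closing a hook produces a loop, discarded whatever its beads: hence [t]
   needs only agree with [s] away from [p] and [q]. *)
Lemma hook_join_loop s t p q : good pred0 s -> s.1 p = q -> s.2 p = 0%R ->
  t.1 =1 s.1 -> (forall x, x <> p -> x <> q -> t.2 x = s.2 x) ->
  sim id (hook_join t p q) s.
Proof.
move=> [inv _ bd] sp bp et1 et2; have ip := inv p; have iq := inv q.
have bq : s.2 q = 0%R by rewrite -sp bd.
split=> x; have ix := inv x; rewrite /= !et1;
  case: (x =P p) => xp /=; case: (x =P q) => xq /=;
  case: (s.1 x =P p) => fxp /=; case: (s.1 x =P q) => fxq /=;
  try congruence; rewrite et2 //; congruence.
Qed.

(** The zigzag behind [t_i t_j t_i = t_i]: the first gluing hands the arc of [r] over to [p] and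
    hooks [q] to [r]; the second one merges these two arcs, which gives [r] its arc back. *)
Lemma hook_join_snake s p q r : good pred0 s -> s.1 p = q -> s.2 p = 0%R ->
  r <> p -> r <> q -> sim id (hook_join (hook_join s q r) p q) s.
Proof.
move=> [inv fixs bd] sp bp rp rq; have ip := inv p; have ir := inv r.
have bq : s.2 q = 0%R by rewrite -sp bd.
have br := bd r.
have /eqP fr : s.1 r != r by rewrite fixs.
have /eqP fp : s.1 p != p by rewrite fixs.
clear fixs.
split=> x; have ix := inv x; have bx := bd x; clear inv bd; rewrite /=.
  case: (x =P p) => xp /=; case: (x =P q) => xq /=;
  case: (x =P r) => xr /=;
  case: (s.1 x =P p) => fxp /=; case: (s.1 x =P q) => fxq /=;
  case: (s.1 x =P r) => fxr /=;
  try congruence; repeat (case: eqP => ? /=); congruence.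
case: (x =P p) => xp /=; case: (x =P q) => xq /=;
  case: (x =P r) => xr /=;
  case: (s.1 x =P p) => fxp /=; case: (s.1 x =P q) => fxq /=;
  case: (s.1 x =P r) => fxr /=;
  try congruence; repeat (case: eqP => ? /=);
  rewrite ?bp ?bq ?GRing.addr0 ?GRing.add0r; congruence.
Qed.

Lemma hook_join_comm s p q p' q' : good pred0 s -> uniq [:: p; q; p'; q'] ->
  sim id (hook_join (hook_join s p q) p' q') (hook_join (hook_join s p' q') p q).
Proof.
move=> [inv fixD bd]; rewrite /= !inE !negb_or !andbT -!andbA.
case/and5P=> /eqP pq /eqP pp' /eqP pq' /eqP qp' /andP[/eqP qq' /eqP p'q'].
have := (inv p, inv q, inv p', inv q') => -[[[ip iq] ip'] iq'].
split=> x; have ix := inv x; rewrite /=;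
  case: (x =P p) => xp /=; case: (x =P q) => xq /=;
  case: (x =P p') => xp' /=; case: (x =P q') => xq' /=;
  case: (s.1 x =P p) => fxp /=; case: (s.1 x =P q) => fxq /=;
  case: (s.1 x =P p') => fxp' /=; case: (s.1 x =P q') => fxq' /=;
  try congruence; repeat (case: eqP => ? /=); try congruence.
all: by rewrite GRing.addrA.
Qed.

Lemma hook_join_add_beads s b p q : good pred0 s -> p <> q ->
  b p = 0%R -> b q = 0%R ->
  sim id (hook_join (add_beads s b) p q) (add_beads (hook_join s p q) b).
Proof.
move=> [inv _ bd] pq bp bq; have ip := inv p; have iq := inv q.
split=> x; first by [].
have ix := inv x; rewrite /=.
case: (x =P p) => [xp|xp] /=; first by rewrite xp bp bq !GRing.addr0.
case: (x =P q) => [xq|xq] /=; first by rewrite xq bp bq !GRing.addr0.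
case: (s.1 x =P p) => [fxp|fxp] /=.
  rewrite fxp bp bq !GRing.addr0 -!GRing.addrA; congr (_ + _)%R.
  by rewrite GRing.addrCA.
case: (s.1 x =P q) => [fxq|fxq] /=; last by [].
rewrite fxq bp bq !GRing.addr0 -!GRing.addrA; congr (_ + _)%R.
by rewrite GRing.addrCA.
Qed.

Definition bead (m : M) x : T -> M := fun y => if y == x then m else 0%R.

(** The arcs of [p] and [q] are merged, so the beads end up on the same arc whichever side they come
    from, or in the same loop. *)
Lemma hook_join_bead s p q m : good pred0 s -> p <> q ->
  sim id (hook_join (add_beads s (bead m p)) p q)
    (hook_join (add_beads s (bead m q)) p q).
Proof.
move=> [inv fixs bd] pq; have ip := inv p; have iq := inv q.
have /eqP fp : s.1 p != p by rewrite fixs.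
have /eqP fq : s.1 q != q by rewrite fixs.
split=> x; first by [].
have ix := inv x; clear inv fixs bd; rewrite /= /bead.
case: (x =P p) => [//|xp] /=; case: (x =P q) => [//|xq] /=.
case: (s.1 x =P p) => fxp /=; case: (s.1 x =P q) => fxq /=; try congruence;
  repeat (case: eqP => ? /=); try congruence; rewrite ?GRing.addr0.
all: by rewrite -!GRing.addrA; congr (_ + _)%R; rewrite GRing.addrC.
Qed.

End HookJoin.

(** Here [p'] and [q'] are the top ends of [t_i]: passing through their bead-free arc amounts to
    gluing [p] to [q] directly. The four points are excluded because [p'] and [q'] are detached on
    one side and still linked on the other. *)
Lemma join_hook (T : finType) (M : zmodType) D (s : arcs T M) p q p' q' : good D s ->
  uniq [:: p; q; p'; q'] -> ~~ D p -> ~~ D q -> s.1 p' = q' -> s.2 p' = 0%R ->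
  forall x, x \notin [:: p; q; p'; q'] ->
  (join (join s (p, p')) (q, q')).1 x = (join s (p, q)).1 x /\
  (join (join s (p, p')) (q, q')).2 x = (join s (p, q)).2 x.
Proof.
move=> [inv fixD bd]; rewrite /= !inE !negb_or !andbT -!andbA.
case/and5P=> /eqP pq /eqP pp' /eqP pq' /eqP qp' /andP[/eqP qq' /eqP p'q'].
rewrite -!fixD => /eqP fp /eqP fq fp' bp' x.
rewrite !inE !negb_or => /and4P[/eqP xp /eqP xq /eqP xp' /eqP xq'].
have := (inv p, inv q, inv p', inv q') => -[[[ip iq] ip'] iq'].
have bq' : s.2 q' = 0%R by rewrite -fp' bd.
have ix := inv x; rewrite /= bp' bq'.
move/eqP/negPf: (xp) => ->; move/eqP/negPf: (xq) => ->.
move/eqP/negPf: (xp') => ->; move/eqP/negPf: (xq') => -> /=.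
clear inv fixD bd; split.
  case: (s.1 x =P p) => fxp /=; case: (s.1 x =P q) => fxq /=;
  case: (s.1 x =P p') => fxp' /=; case: (s.1 x =P q') => fxq' /=;
  try congruence; repeat (case: eqP => ? /=); congruence.
case: (s.1 x =P p) => fxp /=; case: (s.1 x =P q) => fxq /=;
  case: (s.1 x =P p') => fxp' /=; case: (s.1 x =P q') => fxq' /=;
  try congruence; repeat (case: eqP => ? /=); rewrite ?GRing.addr0 ?GRing.add0r;
  congruence.
Qed.

Section RightMultiplication.
Variables n d : nat.
Local Notation E := (endpoint n).
Local Notation M := (residue d).
Local Notation abacus := (abacusJones n d).

Definition bottom_beads (f : 'I_n -> M) (l : seq 'I_n) (x : E) : M :=
  if x is inr k then if k \in l then f k else 0%R else 0%R.

(** Gluing a vertical strand of [b] prolongs an arc of [a] down to the bottom of [b] and adds the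
    beads of the strand. The list is partial for the sake of the induction, and because a hook is
    vertical only away from two positions; the second conclusion says that the rest of [b] is still
    intact. *)
Lemma joins_strands (a b : abacus) (f : 'I_n -> M) (l : seq 'I_n) :
  uniq l -> {in l, forall k, b.1 (inl k) = inr k /\ b.2 (inl k) = f k} ->
  let s := joins (arcs_sum (arcs_of a) (arcs_of b)) (mids l) in
  sim (outer_bot l) (add_beads (arcs_of a) (bottom_beads f l)) s /\
  forall y : E, (forall k, k \in l -> y <> inl k /\ y <> inr k) ->
    s.1 (inr y) = inr (b.1 y) /\ s.2 (inr y) = b.2 y.
Proof.
elim/last_ind: l => [|l k IHl].
  have bb x : bottom_beads f [::] x = 0%R by case: x.
  have ob x : outer_bot [::] x = inl x by case: x.
  move=> _ _; split=> [|//]; split=> x; rewrite !ob //=.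
  by rewrite !bb !GRing.addr0.
rewrite rcons_uniq => /andP[kl ul] bl /=.
have [|[h1 h2] h] := IHl ul.
  by move=> i il; apply: bl; rewrite mem_rcons inE il orbT.
move: h1 h2 h; rewrite -cats1 /mids map_cat /joins foldl_cat /= -/(joins _ _).
set s := joins _ _ => h1 h2 h.
have [inva fixa bda] := abacus_good a; have [invb fixb bdb] := abacus_good b.
rewrite /= in inva fixa bda invb fixb bdb.
have [btop ftop] : b.1 (inl k) = inr k /\ b.2 (inl k) = f k.
  by apply: bl; rewrite mem_rcons mem_head.
have bbot : b.1 (inr k) = inl k by rewrite -btop invb.
have fbot : b.2 (inr k) = f k by rewrite -btop bdb.
have nl : forall i, i \in l -> k <> i by move=> i il e; rewrite e il in kl.
have [stop ctop] : s.1 (inr (inl k)) = inr (inr k) /\ s.2 (inr (inl k)) = f k.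
  by rewrite -btop -ftop; apply: h => i /nl ki; split=> // -[].
have [sbot cbot] : s.1 (inr (inr k)) = inr (inl k) /\ s.2 (inr (inr k)) = f k.
  by rewrite -bbot -fbot; apply: h => i /nl ki; split=> // -[].
have ob_inj : injective (outer_bot l).
  by move=> [j|j] [i|i] /=; do ?case: ifP => //; move=> *; congruence.
have ek : outer_bot l (inr k) = inl (inr k) by rewrite /= (negPf kl).
have obk x : (outer_bot l x == inl (inr k)) = (x == inr k).
  by rewrite -ek (inj_eq ob_inj).
have obq x : (outer_bot l x == inr (inl k)) = false.
  by case: x => //= j; case: ifP.
have obr x : x != inr k -> outer_bot (l ++ [:: k]) x = outer_bot l x.
  case: x => //= j jk; rewrite mem_cat mem_seq1.
  by rewrite [j == k](negPf (jk : j != k)) orbF.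
have obkk : outer_bot (l ++ [:: k]) (inr k) = inr (inr k).
  by rewrite /= mem_cat mem_head orbT.
have bbk : bottom_beads f (l ++ [:: k]) (inr k) = f k.
  by rewrite /= mem_cat mem_head orbT.
have bbk0 : bottom_beads f l (inr k) = 0%R by rewrite /= (negPf kl).
have bbr x : x != inr k ->
    bottom_beads f (l ++ [:: k]) x = bottom_beads f l x.
  case: x => //= j jk; rewrite mem_cat mem_seq1.
  by rewrite [j == k](negPf (jk : j != k)) orbF.
have fixk : a.1 (inr k) != inr k by rewrite fixa.
split; first split=> x.
- have [->|xk] := eqVneq x (inr k).
    by rewrite obkk /= sbot eqxx /= -ek h1 obr.
  rewrite obr //= obk obq (negPf xk) /= h1 obk obq.
  by have [->|axk] := eqVneq (a.1 x) (inr k); rewrite ?stop ?obkk ?obr.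
- have [->|xk] := eqVneq x (inr k).
    rewrite obkk /= sbot eqxx /= -ek h2 cbot /= (negPf kl) mem_cat mem_head.
    by rewrite orbT bbr // GRing.addr0 GRing.addrCA GRing.addrA.
  rewrite obr //= obk obq (negPf xk) /= h1 obk obq h2 /= bbr //.
  have [-> /=|axk] := eqVneq (a.1 x) (inr k); last by rewrite bbr.
  by rewrite (negPf kl) GRing.addr0 mem_cat mem_head orbT ctop.
- move=> y yl; have [yk1 yk2] : y <> inl k /\ y <> inr k.
    by apply: yl; rewrite mem_cat mem_head orbT.
  have [|e1 e2] := h y; first by move=> i il; apply: yl; rewrite mem_cat il.
  rewrite /= e1 e2.
  have n1 z : (inr z : E + E) == inl (inr k) = false by [].
  have n2 z : ((inr z : E + E) == inr (inl k)) = (z == inl k) by [].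
  rewrite n1 n2 /= n2; move/eqP/negPf: yk1 => ->.
  have -> : (b.1 y == inl k) = false; last by [].
  by apply/eqP => e; apply: yk2; rewrite -btop -e invb.
Qed.

Definition strand_beads (f : 'I_n -> M) (x : E) : M :=
  if x is inr k then f k else 0%R.

Lemma abacus_mul_strands (a : abacus) (f : 'I_n -> M) :
  sim id (arcs_of (abacus_mul a (abacus_strands f)))
    (add_beads (arcs_of a) (strand_beads f)).
Proof.
have [|st _] := @joins_strands a (abacus_strands f) f _ (enum_uniq 'I_n).
  by move=> k _; rewrite /= !ffunE.
apply: (sim_inj (@outer_inj n) (sim_mul a (abacus_strands f)) _ (sim_id _)).
have ob : outer_bot (enum 'I_n) =1 outer (n := n).
  by case=> // j /=; rewrite mem_enum.
have bb x : bottom_beads f (enum 'I_n) x = strand_beads f x.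
  by case: x => // j; rewrite /= mem_enum.
by have [e1 e2] := sim_ext ob st; split=> x; rewrite ?e1 ?e2 //= !bb.
Qed.

Lemma ord_hi_neq (i : 'I_n.-1) : (ord_hi i == ord_lo i) = false.
Proof. by rewrite -val_eqE /=; lia. Qed.

(** Isolates the two gluings that meet the hook of [t_i], in order to perform them last. *)
Lemma enum_ord_split (i : 'I_n.-1) :
  exists l1 l2, enum 'I_n = l1 ++ [:: ord_lo i; ord_hi i] ++ l2.
Proof.
exists (take i (enum 'I_n)), (drop i.+2 (enum 'I_n)).
have lt_i := ltn_ord i; have lt_hi := ltn_ord (ord_hi i).
have lt_lo := ltn_ord (ord_lo i).
rewrite -{1}(cat_take_drop i (enum 'I_n)); congr (_ ++ _).
have e1 : nth (ord_lo i) (enum 'I_n) i = ord_lo i.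
  exact: (nth_ord_enum (ord_lo i) (ord_lo i)).
have e2 : nth (ord_lo i) (enum 'I_n) i.+1 = ord_hi i.
  exact: (nth_ord_enum (ord_lo i) (ord_hi i)).
rewrite (drop_nth (ord_lo i)) ?size_enum_ord // e1.
by rewrite (drop_nth (ord_lo i)) ?size_enum_ord // e2.
Qed.

Lemma abacus_mul_hook (a : abacus) (i : 'I_n.-1) :
  sim id (arcs_of (abacus_mul a (abacus_t d i)))
    (hook_join (arcs_of a) (inr (ord_lo i)) (inr (ord_hi i))).
Proof.
have [l1 [l2 en]] := enum_ord_split i.
have := enum_uniq 'I_n; rewrite en => un.
set lo := ord_lo i; set hi := ord_hi i.
have ul : uniq (l2 ++ l1).
  by move: un; rewrite uniq_catCA /= => /and3P[_ _]; rewrite uniq_catC.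
have memE k : (k \in l2 ++ l1) = (k != lo) && (k != hi).
  have := mem_enum 'I_n k; rewrite en !mem_cat !inE -/lo -/hi => allk.
  have : uniq [:: lo, hi & l2 ++ l1].
    by rewrite -[_ :: _]/([:: lo; hi] ++ (l2 ++ l1)) catA uniq_catC catA
      -catA.
  rewrite /= !inE !negb_or => /and3P[/andP[_ lol] hil _].
  move: allk; case: (eqVneq k lo) => [->|] /=; first by rewrite -mem_cat (negPf lol).
  case: (eqVneq k hi) => [->|] /=; first by rewrite -mem_cat (negPf hil).
  by rewrite orbC.
pose f (k : 'I_n) : M := 0%R.
have [|st rest] := @joins_strands a (abacus_t d i) f _ ul.
  move=> k; rewrite memE => /andP[/negPf k1 /negPf k2].
  by rewrite /= !ffunE k1 k2.
set s := joins _ _ in st rest.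
have {}st : sim (outer_bot (l2 ++ l1)) (arcs_of a) s.
  have bb x : bottom_beads f (l2 ++ l1) x = 0%R by case: x => //= k; case: ifP.
  by case: st => t1 t2; split=> x; rewrite ?t1 ?t2 //= !bb !GRing.addr0.
have gs : good (is_mid (l2 ++ l1)) s by exact: good_mids.
have lohi : (lo == hi) = false by rewrite eq_sym ord_hi_neq.
have endi k : k = lo \/ k = hi -> forall j, j \in l2 ++ l1 ->
    (inl k <> inl j :> E /\ inl k <> inr j :> E) /\
    (inr k <> inl j :> E /\ inr k <> inr j :> E).
  move=> ek j; rewrite memE => /andP[/eqP j1 /eqP j2].
  have kj : k <> j by case: ek => ->; apply: not_eq_sym.
  by split; split=> // -[].
have [top1 top2] := rest (inl lo) (fun j jl => (endi lo (or_introl erefl) j jl).1).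
have [top3 top4] := rest (inl hi) (fun j jl => (endi hi (or_intror erefl) j jl).1).
have [bot1 bot2] := rest (inr lo) (fun j jl => (endi lo (or_introl erefl) j jl).2).
have [bot3 bot4] := rest (inr hi) (fun j jl => (endi hi (or_intror erefl) j jl).2).
move: top1 top2 top3 top4 bot1 bot2 bot3 bot4.
rewrite /= !ffunE !eqxx ord_hi_neq => top1 top2 top3 top4 bot1 bot2 bot3 bot4.
(* By [joins_comm] the order of the gluings is irrelevant: all those on vertical strands are already
   done in [s], and the two at the hook remain. *)
have stackE : sim id (stack a (abacus_t d i))
    (join (join s (inl (inr lo), inr (inl lo))) (inl (inr hi), inr (inl hi))).
  rewrite /stack /middle en -[map _ _]/(mids _) catA /mids map_cat.
  rewrite {1}/joins foldl_cat -!/(joins _ _) -!/(mids _).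
  apply: (sim_id_trans (joins_comm (good_sum_abacus _ _) _ _)) => //.
    rewrite -map_cat -/(mids _) uniq_ends_mids //.
    by rewrite -catA.
  rewrite /s /mids !map_cat /joins !foldl_cat /=; exact: sim_id.
have [e1 e2] := sim_comp (sim_mul a (abacus_t d i)) stackE.
have up : uniq [:: inl (inr lo); inl (inr hi); inr (inl lo); inr (inl hi) : E + E].
  have eq1 k j : (inl (inr k) == inl (inr j) :> E + E) = (k == j) by [].
  have eq2 k j : (inr (inl k) == inr (inl j) :> E + E) = (k == j) by [].
  by rewrite /= !inE eq1 eq2 lohi.
have nm1 : ~~ is_mid (l2 ++ l1) (inl (inr lo)) by rewrite /= memE eqxx.
have nm2 : ~~ is_mid (l2 ++ l1) (inl (inr hi)) by rewrite /= memE eqxx andbF.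
have jh := join_hook gs up nm1 nm2 top1 top2.
have ob_inj : injective (outer_bot (l2 ++ l1)).
  by move=> [j|j] [k|k] /=; do ?case: ifP => //; move=> *; congruence.
have ob1 : inl (inr lo) = outer_bot (l2 ++ l1) (inr lo).
  by rewrite /= memE eqxx.
have ob2 : inl (inr hi) = outer_bot (l2 ++ l1) (inr hi).
  by rewrite /= memE eqxx andbF.
have := sim_join (inr lo) (inr hi) ob_inj st; rewrite -ob1 -ob2 => -[j1 j2].
have outerE x : x != inr lo -> x != inr hi ->
    outer_bot (l2 ++ l1) x = outer x /\
    outer x \notin [:: inl (inr lo); inl (inr hi); inr (inl lo); inr (inl hi)].
  case: x => //= k k1 k2; rewrite memE.
  by rewrite [k == lo](negPf (k1 : k != lo)) [k == hi](negPf (k2 : k != hi)).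
have ob_outer x y : outer_bot (l2 ++ l1) x = outer y -> x = y.
  by case: x y => [k|k] [m|m] //=; try case: ifP => // _; congruence.
(* The bottom hook of [t_i] meets no gluing, so it survives as it is; [join_hook] covers the other
   points. *)
have [h1 h2 h3 h4] : [/\ (arcs_of (abacus_mul a (abacus_t d i))).1 (inr lo) = inr hi,
  (arcs_of (abacus_mul a (abacus_t d i))).1 (inr hi) = inr lo,
  (arcs_of (abacus_mul a (abacus_t d i))).2 (inr lo) = 0%R &
  (arcs_of (abacus_mul a (abacus_t d i))).2 (inr hi) = 0%R].
  split.
  - by apply: outer_inj; have := e1 (inr lo); rewrite /= bot1 => <-.
  - by apply: outer_inj; have := e1 (inr hi); rewrite /= bot3 => <-.
  - by have := e2 (inr lo); rewrite /= bot1 bot2 => <-.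
  - by have := e2 (inr hi); rewrite /= bot3 bot4 => <-.
split=> x; have [->|x1] := eqVneq x (inr lo).
- by rewrite h1 /= eqxx.
- have [->|x2] := eqVneq x (inr hi); first by rewrite h2 /= eqxx -/lo -/hi;
    case: eqP => // -[/esym/eqP]; rewrite lohi.
  rewrite /hook_join -/lo -/hi; cbv beta iota delta [fst].
  rewrite (negPf x1) (negPf x2).
  have [obx nx] := outerE x x1 x2; have [k1 k2] := jh _ nx.
  by apply: ob_outer; rewrite -j1 obx -k1; exact: e1.
- by rewrite h3 /= eqxx.
- have [->|x2] := eqVneq x (inr hi); first by rewrite h4 /= eqxx orbT.
  have [obx nx] := outerE x x1 x2; have [k1 k2] := jh _ nx.
  rewrite -[RHS]/((arcs_of (abacus_mul a (abacus_t d i))).2 x) -e2 k2 -obx.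
  exact/esym/j2.
Qed.

End RightMultiplication.

(** * The relations hold between diagrams *)

Section Representation.
Variables n d : nat.
Hypothesis d_gt0 : 0 < d.
Local Notation E := (endpoint n).
Local Notation M := (residue d).
Local Notation abacus := (abacusJones n d).
Local Notation bot i := (inr i : E).
Local Open Scope group_scope.

Definition abacus_letter (l : framed_letter n) : abacus :=
  match l with inl i => abacus_t d i | inr j => abacus_o d j end.

Definition abacus_word (w : seq (framed_letter n)) : abacus :=
  \prod_(l <- w) abacus_letter l.

Lemma abacus_word_cat u v : abacus_word (u ++ v) = abacus_word u * abacus_word v.
Proof. exact: big_cat. Qed.

Lemma abacus_word0 : abacus_word [::] = 1.
Proof. exact: big_nil. Qed.

Lemma abacus_word1 l : abacus_word [:: l] = abacus_letter l.
Proof. by rewrite /abacus_word big_seq1. Qed.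

Lemma abacus_word_cons l w : abacus_word (l :: w) = abacus_letter l * abacus_word w.
Proof. exact: big_cons. Qed.

Definition point_bead : E -> E -> M := bead (inZp 1).

Lemma bead_inZp0 (x y : E) : bead (inZp 0 : M) x y = 0%R.
Proof. by rewrite /bead; case: ifP => // _; apply: val_inj; rewrite /= mod0n. Qed.

Lemma bead_inZpS k (x y : E) :
  bead (inZp k.+1 : M) x y = (bead (inZp k) x y + point_bead x y)%R.
Proof.
rewrite /point_bead /bead; case: ifP => _; last by rewrite GRing.addr0.
by apply: val_inj; rewrite /= modnDm addn1.
Qed.

Lemma abacus_mul_t (a : abacus) (i : 'I_n.-1) :
  sim id (arcs_of (a * abacus_t d i))
    (hook_join (arcs_of a) (bot (ord_lo i)) (bot (ord_hi i))).
Proof. exact: abacus_mul_hook. Qed.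

Lemma abacus_mul_o (a : abacus) (j : 'I_n) :
  sim id (arcs_of (a * abacus_o d j))
    (add_beads (arcs_of a) (point_bead (bot j))).
Proof.
apply: (sim_id_trans (abacus_mul_strands a _)).
by apply: sim_add_beads => //; case.
Qed.

Lemma bot_lo_hi (i : 'I_n.-1) : bot (ord_lo i) <> bot (ord_hi i).
Proof. by move=> [e]; have := ord_hi_neq i; rewrite -val_eqE /= -e eqxx. Qed.

(** Satisfied by every product ending in [t_i] (see [flat_hookM]); the relations whose two sides
    begin with [t_i] and end in [t_i] reduce to statements on such diagrams. *)
Definition flat_hook (a : abacus) (i : 'I_n.-1) :=
  a.1 (bot (ord_lo i)) = bot (ord_hi i) /\ a.2 (bot (ord_lo i)) = 0%R.

Lemma flat_hookM (a : abacus) (i : 'I_n.-1) : flat_hook (a * abacus_t d i) i.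
Proof.
have [e1 e2] := abacus_mul_t a i.
by split; [rewrite -[LHS]e1 /= eqxx | rewrite -[LHS]e2 /= eqxx].
Qed.

(** The beads dropped at [i] all lie on the arc that [t_i] closes, and leave with the loop. *)
Lemma flat_hook_tz (a : abacus) (i : 'I_n.-1) k : flat_hook a i ->
  a * abacus_o d (ord_lo i) ^+ k * abacus_t d i = a.
Proof.
move=> [h1 h2]; apply: abacus_eq.
apply: (sim_id_trans (abacus_mul_t _ i)).
have [e1 e2] : (a * abacus_o d (ord_lo i) ^+ k).1 =1 a.1 /\
    forall x, x <> bot (ord_lo i) -> x <> bot (ord_hi i) ->
    (a * abacus_o d (ord_lo i) ^+ k).2 x = a.2 x.
  elim: k => [|k [IH1 IH2]]; first by rewrite expg0 mulg1.
  rewrite expgSr mulgA; have [e1 e2] := abacus_mul_o (a * abacus_o d (ord_lo i) ^+ k) (ord_lo i).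
  split=> [x|x x1 x2]; first by rewrite -IH1 -[LHS]e1.
  rewrite -[LHS]e2 /= IH2 // IH1 /point_bead /bead.
  move/eqP/negPf: (x1) => ->; case: eqP => [ax|]; last by rewrite !GRing.addr0.
  case: x2; rewrite -h1 -ax; have [inv _ _] := abacus_good a.
  exact/esym/inv.
exact: hook_join_loop (abacus_good a) _ _ _ _.
Qed.

Lemma flat_hook_t (a : abacus) (i : 'I_n.-1) : flat_hook a i ->
  a * abacus_t d i = a.
Proof. by move=> /flat_hook_tz -/(_ 0); rewrite expg0 mulg1. Qed.

Lemma flat_hook_tt (a : abacus) (i j : 'I_n.-1) : flat_hook a i ->
  (i.+1 == j) || (j.+1 == i) -> a * abacus_t d j * abacus_t d i = a.
Proof.
move=> [h1 h2] ij; apply: abacus_eq.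
apply: (sim_id_trans (abacus_mul_t _ i)).
have gs := abacus_good a; have pq := @bot_lo_hi i.
have botE (k m : 'I_n) : k <> m :> nat -> bot k <> bot m by move=> km [/(congr1 val)].
case/orP: ij => /eqP ij.
  apply: (sim_id_trans (sim_hook_join _ _ (abacus_mul_t _ j))).
  have -> : ord_lo j = ord_hi i by apply: ord_inj; rewrite /= ij.
  by apply: hook_join_snake => //; apply: botE; rewrite /= -ij; lia.
(* The mirror image of the previous case: once the two ends of each hook are exchanged,
   [hook_join_snake] applies again. *)
apply: (sim_id_trans (hook_joinC (abacus_good _) pq)).
apply: (sim_id_trans (sim_hook_join _ _ (abacus_mul_t _ j))).
have -> : ord_hi j = ord_lo i by apply: ord_inj; rewrite /= ij.
have rp : bot (ord_lo j) <> bot (ord_lo i) by apply: botE; rewrite /= -ij; lia.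
apply: (sim_id_trans (sim_hook_join _ _ (hook_joinC gs rp))).
have [inv _ bd] := gs.
apply: hook_join_snake => //; first by rewrite -[X in _.1 X]h1; exact: inv.
  by rewrite -[X in _.2 X]h1; have := bd (bot (ord_lo i)); rewrite /= h2.
by apply: botE; rewrite /= -ij; lia.
Qed.

Lemma abacus_tC (i j : 'I_n.-1) (a : abacus) : (i.+1 < j) || (j.+1 < i) ->
  a * abacus_t d i * abacus_t d j = a * abacus_t d j * abacus_t d i.
Proof.
move=> ij; apply: abacus_eq.
apply: (sim_id_trans (abacus_mul_t _ j)); apply: sim_id_sym.
apply: (sim_id_trans (abacus_mul_t _ i)).
apply: (sim_id_trans (sim_hook_join _ _ (abacus_mul_t _ j))); apply: sim_id_sym.
apply: (sim_id_trans (sim_hook_join _ _ (abacus_mul_t _ i))).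
apply: hook_join_comm; first exact: abacus_good.
have botE (k m : 'I_n) : (bot k == bot m) = (k == m :> nat) by [].
by rewrite /= !inE !botE /=; lia.
Qed.

Lemma abacus_zt (i : 'I_n) (j : 'I_n.-1) (a : abacus) :
  i != ord_lo j -> i != ord_hi j ->
  a * abacus_o d i * abacus_t d j = a * abacus_t d j * abacus_o d i.
Proof.
move=> i1 i2; apply: abacus_eq.
apply: (sim_id_trans (abacus_mul_t _ j)); apply: sim_id_sym.
apply: (sim_id_trans (abacus_mul_o _ i)).
apply: (sim_id_trans (sim_add_beads (abacus_mul_t _ j) _)) => //; apply: sim_id_sym.
apply: (sim_id_trans (sim_hook_join _ _ (abacus_mul_o _ i))).
apply: hook_join_add_beads; first exact: abacus_good.
- exact: bot_lo_hi.
- by rewrite /point_bead /bead ifN // eq_sym.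
- by rewrite /point_bead /bead ifN // eq_sym.
Qed.

Lemma abacus_oC (i j : 'I_n) (a : abacus) :
  a * abacus_o d i * abacus_o d j = a * abacus_o d j * abacus_o d i.
Proof.
apply: abacus_eq.
apply: (sim_id_trans (abacus_mul_o _ j)); apply: sim_id_sym.
apply: (sim_id_trans (abacus_mul_o _ i)).
apply: (sim_id_trans (sim_add_beads (abacus_mul_o _ j) _)) => //; apply: sim_id_sym.
apply: (sim_id_trans (sim_add_beads (abacus_mul_o _ i) _)) => //.
exact: add_beadsC.
Qed.

Lemma abacus_mul_oX (a : abacus) (j : 'I_n) k :
  sim id (arcs_of (a * abacus_o d j ^+ k))
    (add_beads (arcs_of a) (bead (inZp k) (bot j))).
Proof.
elim: k => [|k IHk].
  by rewrite expg0 mulg1; apply/sim_id_sym/add_beads0 => x; exact: bead_inZp0.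
rewrite expgSr mulgA; apply: (sim_id_trans (abacus_mul_o _ j)).
apply: (sim_id_trans (sim_add_beads IHk _)) => //.
exact/add_beadsD/bead_inZpS.
Qed.

Lemma abacus_od (j : 'I_n) (a : abacus) : a * abacus_o d j ^+ d = a.
Proof.
apply: abacus_eq; apply: (sim_id_trans (abacus_mul_oX a j d)).
have b0 y : bead (inZp d : M) (bot j) y = 0%R.
  rewrite /bead; case: ifP => // _; apply: val_inj.
  by rewrite /= prednK // modnn.
exact: add_beads0.
Qed.

Lemma abacus_to (i : 'I_n.-1) (a : abacus) :
  a * abacus_t d i * abacus_o d (ord_lo i) = a * abacus_t d i * abacus_o d (ord_hi i).
Proof.
apply: abacus_eq; apply: (sim_id_trans (abacus_mul_o _ _)); apply: sim_id_sym.
apply: (sim_id_trans (abacus_mul_o _ _)).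
have [h _] := flat_hookM a i; have [inv _ _] := abacus_good (a * abacus_t d i).
split=> // x /=; rewrite -!GRing.addrA; congr (_ + _)%R.
rewrite /point_bead /bead -h (inj_eq (inv_inj inv)).
by rewrite (can2_eq inv inv) GRing.addrC.
Qed.

Lemma abacus_ot (i : 'I_n.-1) (a : abacus) :
  a * abacus_o d (ord_lo i) * abacus_t d i = a * abacus_o d (ord_hi i) * abacus_t d i.
Proof.
apply: abacus_eq; apply: (sim_id_trans (abacus_mul_t _ _)); apply: sim_id_sym.
apply: (sim_id_trans (abacus_mul_t _ _)); apply: sim_id_sym.
apply: (sim_id_trans (sim_hook_join _ _ (abacus_mul_o _ _))); apply: sim_id_sym.
apply: (sim_id_trans (sim_hook_join _ _ (abacus_mul_o _ _))); apply: sim_id_sym.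
apply: hook_join_bead; [exact: abacus_good|exact: bot_lo_hi].
Qed.

Lemma abacus_word_nseq k l : abacus_word (nseq k l) = abacus_letter l ^+ k.
Proof.
by elim: k => [|k IHk]; rewrite /= /abacus_word ?big_nil // big_cons expgS -IHk.
Qed.

Lemma abacus_word_rel u v : framed_rel d u v -> abacus_word u = abacus_word v.
Proof.
(* With an arbitrary diagram [a] in front, every relation becomes a statement about right
   multiplications. *)
move=> uv; rewrite -[LHS]mul1g -[RHS]mul1g; move: (1 : abacus) => a.
case: uv => {u v} [i|i j ij|i j ij|i|i j|i|i|i j ij1 ij2|i k];
  rewrite ?abacus_word_cons ?abacus_word_cat ?abacus_word1 ?abacus_word_nseq
    ?abacus_word0 ?mulg1 ?mulgA /=.
- exact/flat_hook_t/flat_hookM.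
- exact: abacus_tC.
- by apply: flat_hook_tt ij; exact: flat_hookM.
- by rewrite abacus_od.
- exact: abacus_oC.
- exact: abacus_to.
- exact: abacus_ot.
- exact: abacus_zt.
- exact/flat_hook_tz/flat_hookM.
Qed.

Lemma abacus_word_cong u v :
  congruence (@framed_rel n d) u v -> abacus_word u = abacus_word v.
Proof.
elim=> {u v} [u v /abacus_word_rel|u|u v _ ->|u v w _ -> _ ->|u u' v v' _ e _ e'] //.
by rewrite !abacus_word_cat e e'.
Qed.

Definition psi (x : framedJones n d) : abacus := abacus_word (repr x).

Lemma psi_word w : psi (word _ w) = abacus_word w.
Proof. by apply: abacus_word_cong; apply/wordP; rewrite /word reprK. Qed.

Lemma psiM : {morph psi : x y / x * y}.
Proof.
move=> x y; have [u ->] := word_surj x; have [v ->] := word_surj y.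
by rewrite [_ * _]word_cat !psi_word abacus_word_cat.
Qed.

Lemma psi1 : psi 1 = 1.
Proof. by rewrite [1]/(word _ [::]) psi_word /abacus_word big_nil. Qed.

Lemma psi_t i : psi (gen_t d i) = abacus_t d i.
Proof. by rewrite psi_word abacus_word1. Qed.

Lemma psi_z j : psi (gen_z d j) = abacus_o d j.
Proof. by rewrite psi_word abacus_word1. Qed.

End Representation.

(** * Jones normal forms *)

(** The bound [hi] is excluded and the descent is empty when [hi <= lo]; exchanging two descents may
    produce such an empty one. *)
Definition descent (hi lo : nat) : seq nat := rev (iota lo (hi - lo)).

(* Products of descents with increasing first letters [< p] and increasing last
   letters [< k]. *)
Fixpoint normal_words (p k : nat) : seq (seq nat) :=
  if p is q.+1 then
    normal_words q k ++
    [seq w ++ descent p j | j <- iota 0 (minn k p), w <- normal_words q j]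
  else [:: [::]].

Lemma descentS hi lo : lo <= hi -> descent hi.+1 lo = hi :: descent hi lo.
Proof.
by move=> h; rewrite /descent subSn // -addn1 iotaD rev_cat /= subnKC.
Qed.

Lemma descent_rcons hi lo : lo < hi -> descent hi lo = rcons (descent hi lo.+1) lo.
Proof. by move=> h; rewrite /descent -[hi - lo]subnSK //= rev_cons. Qed.

Lemma descent_nil hi lo : hi <= lo -> descent hi lo = [::].
Proof. by rewrite /descent => /eqP ->. Qed.

Lemma mem_descent hi lo i : (i \in descent hi lo) = (lo <= i < hi).
Proof. by rewrite mem_rev mem_iota; lia. Qed.

Lemma descent_cat hi m lo : lo <= m <= hi ->
  descent hi lo = descent hi m ++ descent m lo.
Proof.
move=> /andP[h1 h2]; rewrite /descent -rev_cat; congr rev.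
by rewrite (_ : hi - lo = (m - lo) + (hi - m)) ?iotaD ?subnKC //; lia.
Qed.

Lemma mem_normal_words p k w :
  reflect (p = 0 /\ w = [::] \/ exists2 q, p = q.+1 & w \in normal_words q k \/
    exists j v, [/\ j < k, j <= q, v \in normal_words q j & w = v ++ descent p j])
  (w \in normal_words p k).
Proof.
case: p => [|q] /=.
  by rewrite inE; apply: (iffP eqP) => [->|[[_ ->]|[q]]] //; left.
apply: (iffP idP).
  rewrite mem_cat => /orP[wq|/allpairsPdep[j [v [jk vj ->]]]].
    by right; exists q => //; left.
  right; exists q => //; right; exists j, v.
  by move: jk; rewrite mem_iota leq_min ltnS /= => /andP[-> ->].
case=> [[]//|[_ [<-] [wq|[j [v [jk jq vj ->]]]]]]; first by rewrite mem_cat wq.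
rewrite mem_cat; apply/orP; right; apply/allpairsPdep; exists j, v.
by split=> //; rewrite mem_iota leq_min ltnS jk jq.
Qed.

Lemma normal_words_lt p k w i : w \in normal_words p k -> i \in w -> i < p.
Proof.
elim: p k w => [|p IHp] k w; first by rewrite inE => /eqP ->.
case/mem_normal_words=> [[]//|[_ [<-] [wq|[j [v [jk jq vj ->]]]]]].
  by move=> /(IHp _ _ wq); lia.
by rewrite mem_cat mem_descent => /orP[/(IHp _ _ vj)|]; lia.
Qed.

(** Decides whether a descent ending at [k] can be appended: either this is possible at once, or the
    last descent that stands in the way, ending at [j >= k], is exhibited for [descent_exchange]. *)
Lemma normal_words_last p k w : w \in normal_words p p -> w \in normal_words p k \/
  exists q j v, [/\ k <= j, j < q, q <= p, {in v, forall i, i < q}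
    & w = v ++ descent q j].
Proof.
suff H p' : w \in normal_words p p' -> w \in normal_words p k \/
  exists q j v, [/\ k <= j, j < q, q <= p, {in v, forall i, i < q}
    & w = v ++ descent q j] by exact: H.
elim: p p' w => [|p IHp] p' w; first by left.
case/mem_normal_words=> [[]//|[_ [<-] [wq|[j [v [jk jq vj ->]]]]]].
  have [wk|[q [j [v [h1 h2 h3 h4 ->]]]]] := IHp _ _ wq.
    by left; rewrite mem_cat wk.
  by right; exists q, j, v; split=> //; lia.
have [jk'|kj] := ltnP j k; last first.
  right; exists p.+1, j, v; split=> // i /(normal_words_lt vj); lia.
left; apply/mem_normal_words; right; exists p => //; right.
by exists j, v.
Qed.

(** * Reduction of words to normal form from the relations alone *)

Section TemperleyLieb.
Local Open Scope group_scope.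
Variables (G : monoidType) (t : nat -> G) (N : nat).
Hypothesis tt : forall i, i < N -> t i * t i = t i.
Hypothesis tC : forall i j, i < N -> j < N -> i.+1 < j -> t i * t j = t j * t i.
Hypothesis tSt : forall i, i.+1 < N -> t i * t i.+1 * t i = t i.
Hypothesis tPt : forall i, i.+1 < N -> t i.+1 * t i * t i.+1 = t i.+1.

Definition tprod (w : seq nat) : G := \prod_(i <- w) t i.

Lemma tprod_nil : tprod [::] = 1.
Proof. exact: big_nil. Qed.

Lemma tprod_cat u v : tprod (u ++ v) = tprod u * tprod v.
Proof. exact: big_cat. Qed.

Lemma tprod_cons i v : tprod (i :: v) = t i * tprod v.
Proof. exact: big_cons. Qed.

Lemma tprod_rcons v i : tprod (rcons v i) = tprod v * t i.
Proof. by rewrite -cats1 tprod_cat /tprod big_seq1. Qed.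

Lemma tprod_comm i w : i < N ->
  {in w, forall j, j < N /\ ((i.+1 < j) || (j.+1 < i))} ->
  t i * tprod w = tprod w * t i.
Proof.
move=> iN; elim: w => [|j w IHw] h; first by rewrite tprod_nil mulg1 mul1g.
have [jN ij] := h j (mem_head _ _).
have tij : t i * t j = t j * t i by case/orP: ij => ij; [|symmetry]; apply: tC.
rewrite tprod_cons mulgA tij -!mulgA IHw // => m mw.
by apply: h; rewrite inE mw orbT.
Qed.

Lemma tprod_descent_comm hi lo w : hi <= N -> {in w, forall i, i.+1 < lo} ->
  tprod (descent hi lo) * tprod w = tprod w * tprod (descent hi lo).
Proof.
move=> hN; have [hl|lh] := leqP hi lo.
  by rewrite descent_nil // tprod_nil mul1g mulg1.
elim: w => [_|i w IHw h]; first by rewrite tprod_nil mul1g mulg1.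
have il := h i (mem_head _ _).
rewrite tprod_cons mulgA -tprod_comm; last first.
- by move=> j; rewrite mem_descent; lia.
- lia.
by rewrite -!mulgA IHw // => j jw; apply: h; rewrite inE jw orbT.
Qed.

(** [t j] travels to the right up to [t j.+1], which the relation [tSt] erases; the descent breaks
    at the missing letter and its two pieces commute. *)
Lemma descent_absorb hi lo j : hi <= N -> lo <= j -> j.+1 < hi ->
  t j * tprod (descent hi lo) =
  tprod (descent j.+1 lo) * tprod (descent hi j.+2).
Proof.
move=> hN lj jh.
rewrite (@descent_cat hi j.+2 lo); last lia.
rewrite [descent j.+2 lo]descentS; last lia.
rewrite -[RHS]tprod_descent_comm //; last first.
  by move=> i; rewrite mem_descent; lia.
rewrite tprod_cat tprod_cons mulgA [t j * _]tprod_comm; last first.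
- by move=> i; rewrite mem_descent; lia.
- lia.
rewrite -mulgA; congr (_ * _).
by rewrite descentS // tprod_cons !mulgA tSt //; lia.
Qed.

(** The rule that repairs last letters in the wrong order. That of the second descent grows from [k]
    to [j.+2], which makes [normal_descent] terminate. *)
Lemma descent_exchange q p j k : p <= N -> k <= j -> j < q -> q < p ->
  tprod (descent q j) * tprod (descent p k) =
  tprod (descent q k) * tprod (descent p j.+2).
Proof.
move=> pN kj jq qp; rewrite descent_rcons // tprod_rcons -mulgA.
rewrite descent_absorb //; last lia.
by rewrite mulgA (@descent_cat q j.+1 k) ?tprod_cat //; lia.
Qed.

(** The counterpart of [descent_absorb] for a letter on the right: [tPt] erases [t i]. *)
Lemma descent_mul p j i : p <= N -> j <= i -> i.+1 < p ->
  tprod (descent p j) * t i.+1 = tprod (descent i j) * tprod (descent p i.+1).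
Proof.
move=> pN ji ip.
rewrite -tprod_descent_comm //; last by move=> m; rewrite mem_descent; lia.
have -> : descent p j = descent p i.+2 ++ i.+1 :: i :: descent i j.
  by rewrite (@descent_cat p i.+2 j) ?descentS //; lia.
have -> : descent p i.+1 = descent p i.+2 ++ [:: i.+1].
  by rewrite (@descent_cat p i.+2 i.+1) ?[descent i.+2 _]descentS ?[descent i.+1 _]descent_nil //; lia.
rewrite !tprod_cat !tprod_cons tprod_nil mulg1 -!mulgA -tprod_comm; last first.
- by move=> m; rewrite mem_descent; lia.
- lia.
by congr (_ * _); rewrite !mulgA tPt //; lia.
Qed.

Lemma normal_words_min p k : normal_words p k = normal_words p (minn k p).
Proof.
elim: p k => [//|p IHp] k /=; rewrite -minnA minnn; congr (_ ++ _).
by rewrite IHp [RHS]IHp; congr normal_words; lia.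
Qed.

Lemma normal_wordsW p v : v \in normal_words p p -> v \in normal_words p.+1 p.+1.
Proof.
rewrite normal_words_min minnn => vp; rewrite /= mem_cat normal_words_min.
by rewrite (minn_idPr (leqnSn p)) vp.
Qed.

(** Induction on [p - k]. After an exchange the final descent is shorter, and the letters that the
    prefix has acquired are still [< p], so that the prefix can be normalized afresh. *)
Lemma normal_descent p : p < N ->
  (forall w, {in w, forall i, i < p} ->
     exists2 v, v \in normal_words p p & tprod w = tprod v) ->
  forall k a, k <= p -> {in a, forall i, i < p} ->
    exists2 v, v \in normal_words p.+1 p.+1 &
      tprod a * tprod (descent p.+1 k) = tprod v.
Proof.
move=> pN IHp k; move: {2}(p - k) (leqnn (p - k)) => m.
elim: m k => [|m IHm] k km a kp ap.
all: have [v vp ->] := IHp _ ap.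
all: have [vk|[q [j [u [h1 h2 h3 h4 ->]]]]] := normal_words_last k vp.
all: try by (exists (v ++ descent p.+1 k); rewrite ?tprod_cat //;
  apply/mem_normal_words; right; exists p => //; right; exists k, v).
  by exfalso; lia.
rewrite tprod_cat -mulgA descent_exchange // mulgA -tprod_cat.
have lt_u : {in u ++ descent q k, forall i, i < p}.
  by move=> i; rewrite mem_cat mem_descent => /orP[/h4|]; lia.
have [jp|pj] := leqP j.+2 p; first by apply: IHm => //; lia.
(* The exchange has used up the whole second descent. *)
rewrite [descent p.+1 _]descent_nil // tprod_nil mulg1.
have [v' v'p ->] := IHp _ lt_u; exists v' => //.
exact: normal_wordsW.
Qed.

Lemma normal_formP p w : p <= N -> {in w, forall i, i < p} ->
  exists2 v, v \in normal_words p p & tprod w = tprod v.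
Proof.
elim: p w => [|p IHp] w pN.
  case: w => [_|i w /(_ i (mem_head _ _))] //; by exists [::].
have {}IHp w' : {in w', forall i, i < p} ->
    exists2 v, v \in normal_words p p & tprod w' = tprod v by apply: IHp; lia.
have R := normal_descent pN IHp.
elim/last_ind: w => [_|w i IHw h].
  have [//|v vp e] := IHp [::]; exists v => //; exact: normal_wordsW.
have [|v vp wv] := IHw; first by move=> m mw; apply: h; rewrite mem_rcons inE mw orbT.
have ip : i <= p by apply: h; rewrite mem_rcons mem_head.
rewrite tprod_rcons wv.
have [[]//|[_ [<-] [vq|[j [u [jk jq uj ->]]]]]] := mem_normal_words _ _ _ vp.
  rewrite normal_words_min (minn_idPr (leqnSn p)) in vq.
  have lt_v := normal_words_lt vq.
  have [i_lt|pi] := ltnP i p.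
    rewrite -tprod_rcons; have [|v' v'p ->] := IHp (rcons v i).
      by move=> m; rewrite mem_rcons inE => /orP[/eqP->|/lt_v].
    by exists v' => //; exact: normal_wordsW.
  have -> : i = p by lia.
  have [//|v' v'p e] := R p v (leqnn p); exists v' => //.
  by rewrite -e descentS ?descent_nil // tprod_cons tprod_nil mulg1.
have lt_u m : m \in u -> m < p by move=> /(normal_words_lt uj); lia.
(* The new letter [i] against the last letter [j] of the final descent: above it, [descent_mul]
   breaks the descent; equal to it, it is absorbed; just below, it prolongs the descent; further
   below, it commutes into the prefix. Each time [R] concludes. *)
rewrite tprod_cat -mulgA; have [ij|ji] := leqP i j; last first.
  case: i ip ji {h} => // i ip ji.
  rewrite descent_mul //.
  rewrite mulgA -tprod_cat; apply: R => //.
  by move=> m; rewrite mem_cat mem_descent => /orP[/lt_u|]; lia.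
have [->|/eqP nij] := eqVneq i j.
  rewrite [descent _ _]descent_rcons // tprod_rcons -mulgA tt; last lia.
  rewrite -tprod_rcons -descent_rcons //; exact: R.
have [eij|nij'] := eqVneq i.+1 j.
  rewrite -tprod_rcons -eij -descent_rcons; last lia.
  by apply: R => //; lia.
rewrite -tprod_comm; last first.
- by move=> m; rewrite mem_descent; lia.
- lia.
rewrite mulgA -tprod_rcons; apply: R => // m.
by rewrite mem_rcons inE => /orP[/eqP->|/lt_u]; lia.
Qed.

End TemperleyLieb.

(** * Diagrams of normal forms *)

Section NormalDiagrams.
Variables N d : nat.
Local Notation E := (endpoint N.+1).
Local Notation M := (residue d).
Local Notation abacus := (abacusJones N.+1 d).
Local Open Scope group_scope.

(** Indices are natural numbers so that shifts such as [i.+2] make sense; [inord] sends an index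
    above [N] to [0], whence the hypotheses [i <= N] below. *)
Definition top (i : nat) : E := inl (inord i).
Definition bot (i : nat) : E := inr (inord i).

(* Out of range indices give [1]; likewise for [tgen] below. *)
Definition hook (i : nat) : abacus :=
  if insub i is Some j then @abacus_t N.+1 d j else 1.

Lemma hookE i (iN : i < N) : hook i = @abacus_t N.+1 d (Ordinal iN).
Proof. by rewrite /hook insubT. Qed.

Lemma hook_out i : N <= i -> hook i = 1.
Proof. by move=> Ni; rewrite /hook insubF // ltnNge Ni. Qed.

Definition width (x : E) : nat := match x with inl i | inr i => i end.

Lemma endpointP x : exists2 i, i <= N & x = top i \/ x = bot i.
Proof.
by case: x => i; exists i; rewrite -1?ltnS // /top /bot inord_val; [left|right].
Qed.

Lemma topE i j : i <= N -> j <= N -> (top i == top j) = (i == j).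
Proof. by move=> iN jN; rewrite /top -[LHS]/(inord i == inord j) -val_eqE /= !inordK. Qed.

Lemma botE i j : i <= N -> j <= N -> (bot i == bot j) = (i == j).
Proof. by move=> iN jN; rewrite /bot -[LHS]/(inord i == inord j) -val_eqE /= !inordK. Qed.

Lemma top_inj i j : i <= N -> j <= N -> top i = top j -> i = j.
Proof. by move=> iN jN /eqP; rewrite topE // => /eqP. Qed.

Lemma bot_inj i j : i <= N -> j <= N -> bot i = bot j -> i = j.
Proof. by move=> iN jN /eqP; rewrite botE // => /eqP. Qed.

Lemma boundary_top i : i <= N -> boundary (top i) = i.
Proof. by move=> iN; rewrite /= inordK. Qed.

Lemma boundary_bot i : i <= N -> boundary (bot i) = (N + N).+1 - i.
Proof. by move=> iN; rewrite /= inordK // addnS. Qed.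

Lemma width_top i : i <= N -> width (top i) = i.
Proof. exact: inordK. Qed.

Lemma width_bot i : i <= N -> width (bot i) = i.
Proof. exact: inordK. Qed.

Lemma mul_hook (a : abacus) i : i < N ->
  sim id (arcs_of (a * hook i)) (hook_join (arcs_of a) (bot i) (bot i.+1)).
Proof.
move=> iN; rewrite /hook insubT.
have := @abacus_mul_t N.+1 d a (Ordinal iN); rewrite /=.
have -> : ord_lo (Ordinal iN : 'I_N.+1.-1) = inord i.
  by apply: ord_inj; rewrite inordK //= ltnW.
have -> : ord_hi (Ordinal iN : 'I_N.+1.-1) = inord i.+1.
  by apply: ord_inj; rewrite inordK.
by [].
Qed.

Definition flat (a : abacus) := forall x, a.2 x = 0%R.
(** [vertical_from p.+1] and [hooks_below k] are the traces on diagrams of the two bounds of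
    [normal_words p k]. *)
Definition vertical_from m (a : abacus) :=
  forall j, m <= j -> j <= N -> a.1 (top j) = bot j.
Definition hooks_below k (a : abacus) :=
  forall i, i < N -> a.1 (bot i) = bot i.+1 -> i < k.

Lemma abacusK (a : abacus) : involutive a.1.
Proof. by have [] := abacus_good a. Qed.

Lemma abacus_neq (a : abacus) x : a.1 x <> x.
Proof. by have [_ fixa _] := abacus_good a; apply/eqP; rewrite fixa. Qed.

Lemma flat_one : flat 1.
Proof. by move=> x; rewrite ffunE; case: x. Qed.

Lemma one_top i : (1 : abacus).1 (top i) = bot i.
Proof. by rewrite ffunE. Qed.

Lemma one_bot i : (1 : abacus).1 (bot i) = top i.
Proof. by rewrite ffunE. Qed.

Lemma flat_mul (a : abacus) i : i < N -> flat a -> flat (a * hook i).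
Proof.
move=> iN fa x; have [_ e2] := mul_hook a iN.
rewrite -[LHS]e2 /= !fa GRing.addr0; by do !case: ifP.
Qed.

Lemma flat_tprod (a : abacus) w : {in w, forall i, i < N} -> flat a ->
  flat (a * tprod hook w).
Proof.
elim: w a => [|i w IHw] a h fa; first by rewrite tprod_nil mulg1.
rewrite tprod_cons mulgA; apply: IHw => [j jw|].
  by apply: h; rewrite inE jw orbT.
by apply: flat_mul => //; apply: h; exact: mem_head.
Qed.

Lemma flat_eq (a b : abacus) : flat a -> flat b -> a.1 =1 b.1 -> a = b.
Proof.
move=> fa fb ab; apply: abacus_eq; split=> x; first exact/esym/ab.
by rewrite /= fa fb.
Qed.

(* The bottom of [a * t_p ... t_k], for [a] with vertical strands from [p.+1]
   on: a hook is inserted at [k], the next bottom points are shifted by two,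
   and the last one moves to the top. *)
Definition insert_hook p k (x : E) : E :=
  match x with
  | inl i => inl i
  | inr j => if j < k then inr j else if j < p then bot j.+2 else top p.+1
  end.

Lemma insert_hook_top p k i : i <= N -> insert_hook p k (top i) = top i.
Proof. by []. Qed.

Lemma insert_hook_lo p k i : i <= N -> i < k -> insert_hook p k (bot i) = bot i.
Proof. by move=> iN ik; rewrite /= inordK // ik. Qed.

Lemma insert_hook_hi p k i : i <= N -> k <= i -> i < p ->
  insert_hook p k (bot i) = bot i.+2.
Proof. by move=> iN ki ip; rewrite /= inordK // ltnNge ki /= ip. Qed.

Lemma insert_hook_last p k : p <= N -> k <= p ->
  insert_hook p k (bot p) = top p.+1.
Proof. by move=> pN kp; rewrite /= inordK // ltnNge kp /= ltnn. Qed.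

Lemma insert_hookP p k x : p < N -> k <= p -> width x <= p ->
  [\/ exists2 i, i <= p & x = top i /\ insert_hook p k x = top i,
      exists2 i, i < k & x = bot i /\ insert_hook p k x = bot i,
      exists2 i, k <= i < p & x = bot i /\ insert_hook p k x = bot i.+2
    | x = bot p /\ insert_hook p k x = top p.+1].
Proof.
move=> pN kp; have [i iN [->|->]] := endpointP x.
  by rewrite width_top // => ip; constructor 1; exists i.
rewrite width_bot // => ip.
have [ik|ki] := ltnP i k.
  by constructor 2; exists i => //; rewrite insert_hook_lo.
have [ip'|pi] := ltnP i p.
  by constructor 3; exists i; rewrite ?ki // insert_hook_hi.
have -> : i = p by lia.
by constructor 4; rewrite insert_hook_last // ltnW.
Qed.

Lemma vertical_width p (a : abacus) x : vertical_from p.+1 a ->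
  width x <= p -> width (a.1 x) <= p.
Proof.
move=> va xp; rewrite leqNgt; apply/negP => lt_p.
have [i iN [ax|ax]] := endpointP (a.1 x); move: lt_p;
  rewrite ax ?width_top ?width_bot // => lt_p;
  have av := va i lt_p iN; move: xp.
  by rewrite -(abacusK a x) ax av width_bot // leqNgt lt_p.
by rewrite -(abacusK a x) ax -av abacusK width_top // leqNgt lt_p.
Qed.

Lemma mul_hook_at (a : abacus) i : i < N -> (a * hook i).1 (bot i) = bot i.+1.
Proof.
by move=> iN; have [e1 _] := mul_hook a iN; rewrite -[LHS]e1 /= eqxx.
Qed.

Lemma mul_hook_off (a : abacus) i x : i < N -> x <> bot i -> x <> bot i.+1 ->
  (a * hook i).1 x = if a.1 x == bot i then a.1 (bot i.+1)
                     else if a.1 x == bot i.+1 then a.1 (bot i) else a.1 x.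
Proof.
move=> iN /eqP/negPf x1 /eqP/negPf x2; have [e1 _] := mul_hook a iN.
by rewrite -[LHS]e1 /= x1 x2.
Qed.

(** Induction on the length of the descent. Its first letter [t_p] meets the vertical strand [p.+1],
    which takes the arc of [bot p] up to [top p.+1]. *)
Lemma mul_descent (a : abacus) p k : p < N -> k <= p -> vertical_from p.+1 a ->
  let b := a * tprod hook (descent p.+1 k) in
  [/\ forall x, width x <= p -> b.1 (insert_hook p k x) = insert_hook p k (a.1 x),
      b.1 (bot k) = bot k.+1 & vertical_from p.+2 b].
Proof.
move=> pN kp va; move: {2}(p - k) (erefl (p - k)) => m.
elim: m k kp => [|m IHm] k kp mk.
  have {kp mk} -> : k = p by lia.
  rewrite descentS // descent_nil // tprod_cons tprod_nil mulg1 /=.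
  have ins x : width x <= p -> x <> bot p -> insert_hook p p x = x.
    move=> xp nx; have [[i ip [-> ->]]|[i ip [-> ->]]|[i ip _]|[ex _]] // :=
      insert_hookP pN (leqnn p) xp; by lia.
  have va1 : a.1 (top p.+1) = bot p.+1 by exact: va.
  have va2 : a.1 (bot p.+1) = top p.+1 by rewrite -va1 abacusK.
  have wb : width (bot p) <= p by rewrite width_bot // ltnW.
  have nb x : width x <= p -> x <> bot p.+1.
    by move=> xp e; move: xp; rewrite e width_bot // ltnn.
  split.
  - move=> x xp; have axp := vertical_width va xp.
    have [->|/eqP nx] := eqVneq x (bot p).
      rewrite insert_hook_last // 1?ltnW // mul_hook_off // va1 eqxx.
      rewrite (negPf (_ : bot p.+1 != bot p)) ?botE ?(ltnW pN) //; last lia.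
      rewrite ins //; first exact: vertical_width.
      exact: abacus_neq.
    rewrite ins // mul_hook_off //; last exact: nb.
    have [->|/eqP nax] := eqVneq (a.1 x) (bot p).
      by rewrite va2 insert_hook_last // ltnW.
    have /eqP/negPf -> := nb _ axp.
    by rewrite ins.
  - exact: mul_hook_at.
  - move=> j pj jN; rewrite mul_hook_off //.
    have -> : a.1 (top j) = bot j by apply: va => //; lia.
    rewrite !botE ?(ltnW pN) //.
    by do 2 (case: eqP => [?|_]; first lia).
have [h1 h2 h3] : let b := a * tprod hook (descent p.+1 k.+1) in
  [/\ forall x, width x <= p ->
        b.1 (insert_hook p k.+1 x) = insert_hook p k.+1 (a.1 x),
      b.1 (bot k.+1) = bot k.+2 & vertical_from p.+2 b].
  by apply: IHm; lia.
(* The last letter [t_k] moves the hook from [k.+1] to [k] and carries the arc of [bot k] over to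
   [bot k.+2]; nothing else changes. *)
rewrite descent_rcons ?ltnS // tprod_rcons mulgA /=.
set b := a * _ in h1 h2 h3 *.
have kN : k < N by lia.
have insS x : width x <= p -> x <> bot k ->
    [/\ insert_hook p k x = insert_hook p k.+1 x,
        insert_hook p k.+1 x <> bot k & insert_hook p k.+1 x <> bot k.+1].
  move=> xp nx.
  have lt_kp : k < p by lia.
  have [[i ip [ex ->]]|[i ip [ex ->]]|[i ip [ex ->]]|[ex ->]] :=
    insert_hookP pN lt_kp xp.
  - by rewrite ex.
  - have ik : i != k by apply: contra_not_neq nx => <-.
    rewrite ex insert_hook_lo; [|lia|lia].
    by split=> // /bot_inj; lia.
  - rewrite ex insert_hook_hi; [|lia|lia|lia].
    by split=> // /bot_inj; lia.
  - by rewrite ex insert_hook_last //; lia.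
have insk1 : insert_hook p k.+1 (bot k) = bot k by rewrite insert_hook_lo //; lia.
have insk : insert_hook p k (bot k) = bot k.+2 by rewrite insert_hook_hi //; lia.
have h2' : b.1 (bot k.+2) = bot k.+1 by rewrite -h2 abacusK.
split.
- move=> x xp; have axp := vertical_width va xp.
  have [ex|/eqP nx] := eqVneq x (bot k).
    rewrite ex insk mul_hook_off //; try (by move=> /bot_inj; lia).
    rewrite h2' eqxx botE; try lia.
    rewrite (_ : (k.+1 == k) = false); last lia.
    rewrite -[X in b.1 X]insk1 h1; last by rewrite width_bot; lia.
    by have [||->] := insS (a.1 (bot k)); [rewrite -ex|exact: abacus_neq|].
  have [e1 n1 n2] := insS x xp nx.
  rewrite e1 mul_hook_off // h1 //.
  have [->|/eqP nax] := eqVneq (a.1 x) (bot k).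
    by rewrite insk1 eqxx h2 insk.
  by have [-> /eqP/negPf -> /eqP/negPf ->] := insS _ axp nax.
- exact: mul_hook_at.
- move=> j pj jN; rewrite mul_hook_off // (h3 j pj jN) !botE; [|lia..].
  by do 2 (case: eqP => [?|_]; first lia).
Qed.

End NormalDiagrams.

(** * Distinct normal words have distinct diagrams *)

Section NormalWords.
Variables N d : nat.
Local Notation E := (endpoint N.+1).
Local Notation M := (residue d).
Local Notation abacus := (abacusJones N.+1 d).

Lemma inl_top (i : 'I_N.+1) : inl i = top N i.
Proof. by rewrite /top inord_val. Qed.

Lemma inr_bot (i : 'I_N.+1) : inr i = bot N i.
Proof. by rewrite /bot inord_val. Qed.

Local Notation hook := (@hook N d).
Local Notation top := (@top N).
Local Notation bot := (@bot N).
Local Open Scope group_scope.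

Lemma noncrossingP (a : abacus) (x y : E) :
  ~ (boundary x < boundary y /\ boundary y < boundary (a.1 x) /\
     boundary (a.1 x) < boundary (a.1 y)).
Proof.
have /'forall_forallP nc := abacus_noncrossing a.
by move=> [h1 [h2 h3]]; have := nc x y; rewrite h1 h2 h3.
Qed.

(** The arc of [i.+1] is trapped by noncrossing under the arc from [i] to [j], so it is shorter and
    the induction goes on with it. *)
Lemma innermost_hook (a : abacus) i j : i < j -> j <= N ->
  a.1 (bot i) = bot j -> exists k, [/\ i <= k, k < j & a.1 (bot k) = bot k.+1].
Proof.
move: {2}(j - i) (leqnn (j - i)) => m; elim: m i j => [|m IHm] i j; first by lia.
move=> jim ij jN aij; have [eij|/eqP nij] := eqVneq i.+1 j.
  by exists i; rewrite eij.
have aji : a.1 (bot j) = bot i by rewrite -aij abacusK.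
set z := a.1 (bot i.+1); have az : a.1 z = bot i.+1 by rewrite abacusK.
have bz k : k <= N -> i.+1 <> k -> a.1 z <> bot k.
  by move=> kN ik; rewrite az => /bot_inj; lia.
have zj : boundary z <> boundary (bot j).
  by move=> /boundary_inj e; apply: (bz i); rewrite ?e ?aji //; lia.
have zi : boundary z <> boundary (bot i).
  by move=> /boundary_inj e; apply: (bz j); rewrite ?e ?aij //.
have := @noncrossingP a (bot j) (bot i.+1); have := @noncrossingP a z (bot j).
rewrite aji az -/z; move: zi zj.
rewrite !boundary_bot; [|lia..].
have [k kN [ez|ez]] := endpointP z; rewrite ez ?boundary_top ?boundary_bot //.
  by lia.
move=> h1 h2 h3 h4.
have ki : k <> i.+1 by move=> ki; apply: (@abacus_neq _ _ a (bot i.+1)); rewrite -/z ez ki.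
have [||||m' [m1 m2 m3]] := IHm i.+1 k; try lia.
  by rewrite -/z ez.
by exists m'; split=> //; lia.
Qed.

(** If no arc joined two bottom points, counting would make every arc go from top to bottom; the
    arcs of [top p.+1] and [bot p.+1], being distinct, would then cross. *)
Lemma exists_hook (a : abacus) p : p < N -> vertical_from p.+2 a ->
  a.1 (top p.+1) <> bot p.+1 -> exists2 k, k <= p & a.1 (bot k) = bot k.+1.
Proof.
move=> pN va np.
have low (x y : 'I_N.+1) : a.1 (inr x) = inr y -> x <= p.+1.
  move=> axy; rewrite leqNgt; apply/negP => px.
  have := va x px (leq_ord x); rewrite -inl_top -inr_bot => e.
  by move: axy; rewrite -e abacusK.
suff [i [j [ij jp aij]]] : exists i j, [/\ i < j, j <= p.+1 & a.1 (bot i) = bot j].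
  have [|k [k1 k2 ak]] := innermost_hook ij _ aij; first lia.
  by exists k => //; lia.
apply: contrapT => nb.
have bt (j : 'I_N.+1) : exists i, a.1 (inr j) = inl i.
  case aj: (a.1 (inr j)) => [i|i]; first by exists i.
  have aj' : a.1 (inr i) = inr j by rewrite -aj abacusK.
  exfalso; apply: nb.
  have [lt_ji|lt_ij|/ord_inj ji] := ltngtP (j : nat) (i : nat).
  - by exists j, i; rewrite -!inr_bot (low _ _ aj').
  - by exists i, j; rewrite -!inr_bot (low _ _ aj).
  by have := @abacus_neq _ _ a (inr j); rewrite aj ji.
pose g (j : 'I_N.+1) : 'I_N.+1 := if a.1 (inr j) is inl i then i else j.
have gE j : a.1 (inr j) = inl (g j) by rewrite /g; have [i ->] := bt j.
have g_inj : injective g.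
  move=> j k e; have := gE j; rewrite e -gE => /(inv_inj (@abacusK _ _ a)).
  by case.
have tb (i : 'I_N.+1) : exists j, a.1 (inl i) = inr j.
  have /codomP[j ->] : i \in codom g by rewrite inj_card_onto.
  by exists j; rewrite -gE abacusK.
have [j aj] := tb (inord p.+1); have [i ai] := bt (inord p.+1).
have {}aj : a.1 (top p.+1) = bot j by rewrite aj inr_bot.
have {}ai : a.1 (bot p.+1) = top i by rewrite ai inl_top.
have ip : i < p.+1.
  rewrite ltnNge leq_eqVlt; apply/negP => /orP[/eqP pi|lt_pi].
    by apply: np; rewrite -[bot _](abacusK a) ai -pi.
  have e := va i lt_pi (leq_ord i); have lt_i := leq_ord i.
  have := abacusK a (top i); rewrite e -ai.
  by move=> /(inv_inj (@abacusK _ _ a)) /bot_inj; lia.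
have jp : j < p.+1.
  rewrite ltnNge leq_eqVlt; apply/negP => /orP[/eqP pj|lt_pj].
    by apply: np; rewrite aj pj.
  have e := va j lt_pj (leq_ord j); have lt_j := leq_ord j.
  have := abacusK a (top j); rewrite e -aj abacusK => /top_inj; lia.
apply: (@noncrossingP a (top i) (top p.+1)).
have ai' : a.1 (top i) = bot p.+1 by rewrite -ai abacusK.
have := leq_ord i; have := leq_ord j.
by rewrite ai' aj !boundary_top ?boundary_bot; lia.
Qed.

(** Inverse of [insert_hook p k]; its values at the ends of the hook, [bot k] and [bot k.+1], are
    meaningless. *)
Definition remove_hook p k (x : E) : E :=
  match x with
  | inl i => if (i : nat) == p.+1 then bot p else inl i
  | inr j => if j < k then inr j else bot j.-2
  end.

Lemma insert_hookK p k x : p < N -> k <= p -> width x <= p ->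
  remove_hook p k (insert_hook p k x) = x.
Proof.
move=> pN kp xp.
have [[i ip [ex ->]]|[i ik [ex ->]]|[i ikp [ex ->]]|[ex ->]] :=
  insert_hookP pN kp xp; rewrite ex /= inordK; try lia.
- by rewrite (_ : (i == _) = false) //; lia.
- by rewrite ik.
- by rewrite ifN //; lia.
- by rewrite eqxx.
Qed.

Lemma remove_hookK p k x : p < N -> k <= p -> width x <= p.+1 ->
  x <> bot k -> x <> bot k.+1 ->
  insert_hook p k (remove_hook p k x) = x /\ width (remove_hook p k x) <= p.
Proof.
move=> pN kp; have [i iN [->|->]] := endpointP x.
  rewrite width_top // => ip _ _.
  rewrite [remove_hook _ _ _]/= inordK //; case: eqP => [->|nip].
    by split; rewrite ?insert_hook_last ?width_bot //; lia.
  by split; rewrite ?insert_hook_top ?width_top //; lia.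
rewrite width_bot // => ip /eqP; rewrite botE; [|lia..] => /eqP ik /eqP.
rewrite botE; [|lia..] => /eqP ik'.
rewrite [remove_hook _ _ _]/= inordK //; case: ifP => lt_ik.
  by split; rewrite ?insert_hook_lo ?width_bot //; lia.
rewrite insert_hook_hi ?width_bot; [|lia..].
by split; [congr bot|]; lia.
Qed.

Lemma insert_hook_inj p k (x y : E) : p < N -> k <= p -> width x <= p -> width y <= p ->
  insert_hook p k x = insert_hook p k y -> x = y.
Proof.
by move=> pN kp xp yp e; rewrite -(insert_hookK pN kp xp) e insert_hookK.
Qed.

(* Hence [k] and the presence of a last descent can be read off the diagram,
   which makes the factorization unique. *)
Lemma mul_descent_hooks (a : abacus) p k : p < N -> k <= p ->
  vertical_from p.+1 a -> hooks_below k a ->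
  let b := a * tprod hook (descent p.+1 k) in
  hooks_below k.+1 b /\ b.1 (top p.+1) <> bot p.+1.
Proof.
move=> pN kp va ha b; have [h1 h2 h3] := mul_descent pN kp va.
rewrite -/b in h1 h2 h3.
have wid i : i <= p -> width (bot i) <= p by move=> ip; rewrite width_bot; lia.
split.
  move=> i iN bi; rewrite ltnNge; apply/negP => ki.
  have ip : i <= p.
    rewrite leqNgt; apply/negP => pi.
    have := h3 i.+1 pi iN; by rewrite -bi => /(inv_inj (@abacusK _ _ b)).
  have [eik|/eqP nik] := eqVneq i k.+1.
    move: bi; rewrite eik -h2 abacusK => /bot_inj; lia.
  (* A hook of [b] beyond [k.+1] is the shift by two of a hook of [a] at [i - 2 >= k], excluded by
     [ha]. *)
  have e1 : bot i = insert_hook p k (bot (i - 2)).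
    by rewrite insert_hook_hi; [congr bot| | |]; lia.
  have e2 : bot i.+1 = insert_hook p k (bot (i - 2).+1).
    by rewrite insert_hook_hi; [congr bot| | |]; lia.
  move: bi; rewrite e1 e2 h1 ?wid //; last lia.
  move=> /insert_hook_inj e; have := ha (i - 2).
  have -> : a.1 (bot (i - 2)) = bot (i - 2).+1.
    by apply: e => //; [apply: vertical_width => //; apply: wid|apply: wid]; lia.
  by move=> /(_ _ erefl); lia.
(* A vertical strand at [p.+1] would come from an arc of [a] between [bot p] and [bot p.-1], a hook
   at [p.-1 >= k]; when [k = p], the point [bot p.+1] is an end of the new hook and is not in the
   image of [insert_hook]. *)
rewrite -(@insert_hook_last N p k) ?(ltnW pN) // h1 ?wid // => e.
have [kp'|pk] := ltnP k p; last first.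
  have ax : width (a.1 (bot p)) <= p by apply: vertical_width => //; exact: wid.
  have [[i ip [_ ei]]|[i ik [_ ei]]|[i ikp _]|[_ ei]] := insert_hookP pN kp ax.
  - by move: e; rewrite ei.
  - by move: e; rewrite ei => /bot_inj; lia.
  - by lia.
  - by move: e; rewrite ei.
have e2 : bot p.+1 = insert_hook p k (bot p.-1).
  by rewrite insert_hook_hi; [congr bot| | |]; lia.
move: e; rewrite e2 => /insert_hook_inj e.
have {}e : a.1 (bot p) = bot p.-1.
  by apply: e => //; [apply: vertical_width => //; apply: wid|apply: wid]; lia.
have {}e : a.1 (bot p.-1) = bot p by rewrite -e abacusK.
have := ha p.-1; rewrite e (_ : p.-1.+1 = p); last lia.
by move=> /(_ _ erefl); lia.
Qed.

Lemma mul_descent_inj (a a' : abacus) p k : p < N -> k <= p ->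
  vertical_from p.+1 a -> vertical_from p.+1 a' -> flat a -> flat a' ->
  a * tprod hook (descent p.+1 k) = a' * tprod hook (descent p.+1 k) -> a = a'.
Proof.
move=> pN kp va va' fa fa' e; apply: flat_eq => // x.
have [h1 _ _] := mul_descent pN kp va; have [h1' _ _] := mul_descent pN kp va'.
have [xp|px] := leqP (width x) p.
  apply: (@insert_hook_inj p k) => //; try exact: vertical_width.
  by rewrite -h1 // e h1'.
have [i iN [ex|ex]] := endpointP x; move: px; rewrite ex ?width_top ?width_bot // => px.
  by rewrite va ?va'.
by rewrite -{1}(va i px iN) -(va' i px iN) !abacusK.
Qed.

Lemma hooks_belowW k m (a : abacus) : k <= m -> hooks_below k a -> hooks_below m a.
Proof. by move=> km ha i iN /(ha i iN) ik; exact: leq_trans km. Qed.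

Lemma normal_words_diagram p k w : p <= N -> w \in normal_words p k ->
  [/\ vertical_from p.+1 (tprod hook w), hooks_below k (tprod hook w)
    & flat (tprod hook w)].
Proof.
elim: p k w => [|p IHp] k w pN.
  rewrite inE => /eqP ->; rewrite tprod_nil; split.
  - by move=> j _ _; exact: one_top.
  - by move=> i iN; rewrite one_bot.
  - exact: flat_one.
case/mem_normal_words=> [[]//|[_ [<-] [wq|[j [v [jk jq vj ->]]]]]].
  have [h1 h2 h3] := IHp k w (ltnW pN) wq; split=> // j pj; apply: h1; lia.
have [h1 h2 h3] := IHp j v (ltnW pN) vj; rewrite tprod_cat.
have [_ _ h4] := mul_descent pN jq h1.
have [h5 _] := mul_descent_hooks pN jq h1 h2.
split=> //; first exact: hooks_belowW h5.
by apply: flat_tprod => // i; rewrite mem_descent; lia.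
Qed.

Lemma tprod_descent_eq p j j' v v' : p < N -> j <= p -> j' <= p ->
  v \in normal_words p j -> v' \in normal_words p j' ->
  tprod hook (v ++ descent p.+1 j) = tprod hook (v' ++ descent p.+1 j') ->
  j = j' /\ tprod hook v = tprod hook v'.
Proof.
move=> pN jp jp' vj vj'; rewrite !tprod_cat => e.
have [h1 h2 h3] := normal_words_diagram (ltnW pN) vj.
have [h1' h2' h3'] := normal_words_diagram (ltnW pN) vj'.
have [_ k1 _] := mul_descent pN jp h1; have [_ k1' _] := mul_descent pN jp' h1'.
have [k2 _] := mul_descent_hooks pN jp h1 h2.
have [k2' _] := mul_descent_hooks pN jp' h1' h2'.
have ejj : j = j'.
  have := k2 j'; rewrite e => /(_ _ k1'); have := k2' j; rewrite -e => /(_ _ k1).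
  by lia.
by split=> //; move: e h1 h1'; rewrite ejj => e h1 h1'; apply: mul_descent_inj e.
Qed.

Lemma normal_words_inj p k w w' : p <= N -> w \in normal_words p k ->
  w' \in normal_words p k -> tprod hook w = tprod hook w' -> w = w'.
Proof.
elim: p k w w' => [|p IHp] k w w' pN.
  by rewrite !inE => /eqP -> /eqP ->.
(* Only the words without a final descent leave the strand [p.+1] vertical. *)
have mixed v v' j : v \in normal_words p k -> j <= p ->
    v' \in normal_words p j -> tprod hook v <> tprod hook (v' ++ descent p.+1 j).
  move=> vk jp vj; have [h1 _ _] := normal_words_diagram (ltnW pN) vk.
  have [h1' h2' _] := normal_words_diagram (ltnW pN) vj.
  have [_ k2] := mul_descent_hooks pN jp h1' h2'; rewrite tprod_cat => e.
  by apply: k2; rewrite -e; apply: h1.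
case/mem_normal_words=> [[]//|[_ [<-] [wq|[j [v [jk jq vj ->]]]]]];
  case/mem_normal_words=> [[]//|[_ [<-] [wq'|[j' [v' [jk' jq' vj' ->]]]]]].
- exact: IHp (ltnW pN) wq wq'.
- by move=> /mixed; case.
- by move=> /esym/mixed; case.
- move=> /(tprod_descent_eq pN jq jq' vj vj')[ej ev]; move: vj ev.
  by rewrite ej => vj /(IHp _ _ _ (ltnW pN) vj vj') ->.
Qed.

End NormalWords.

(** * Every bead-free diagram comes from a normal word *)

Section NormalWordsSurjective.
Variables N d : nat.
Local Notation E := (endpoint N.+1).
Local Notation M := (residue d).
Local Notation abacus := (abacusJones N.+1 d).
Local Notation hook := (@hook N d).
Local Notation top := (@top N).
Local Notation bot := (@bot N).
Local Open Scope group_scope.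

Lemma vertical_hook m (a : abacus) i : vertical_from m a -> i < N ->
  a.1 (bot i) = bot i.+1 -> i.+1 < m.
Proof.
move=> va iN ai; rewrite ltnNge; apply/negP => mi.
by have := va i.+1 mi iN; rewrite -ai => /(inv_inj (@abacusK _ _ a)).
Qed.

Lemma insert_hook_avoid p k (x : E) : p < N -> k <= p -> width x <= p ->
  [/\ width (insert_hook p k x) <= p.+1, insert_hook p k x <> bot k
    & insert_hook p k x <> bot k.+1].
Proof.
move=> pN kp xp.
have [[i ip [ex ->]]|[i ik [ex ->]]|[i ikp [ex ->]]|[ex ->]] :=
  insert_hookP pN kp xp; rewrite ?width_top ?width_bot //; try lia.
- by split=> //; lia.
- by split=> [|/bot_inj|/bot_inj]; lia.
- by split=> [|/bot_inj|/bot_inj]; lia.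
Qed.

(** Read along the boundary, [bot p] follows [top p] among the points of width at most [p], and so
    does its image [top p.+1] among the images. Noncrossing can thus be pulled back along
    [insert_hook]. *)
Lemma insert_hook_mono p k (x y : E) : p < N -> k <= p ->
  width x <= p -> width y <= p ->
  (boundary (insert_hook p k x) < boundary (insert_hook p k y))
    = (boundary x < boundary y).
Proof.
move=> pN kp xp yp.
have [[i ip [-> ->]]|[i ip [-> ->]]|[i ip [-> ->]]|[-> ->]] :=
  insert_hookP pN kp xp;
have [[j jp [-> ->]]|[j jp [-> ->]]|[j jp [-> ->]]|[-> ->]] :=
  insert_hookP pN kp yp; rewrite ?boundary_top ?boundary_bot; lia.
Qed.

Lemma remove_hook_diagram (a : abacus) p k : p < N -> k <= p ->
  vertical_from p.+2 a -> flat a -> a.1 (bot k) = bot k.+1 ->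
  exists b : abacus, [/\ vertical_from p.+1 b, flat b
    & b * tprod hook (descent p.+1 k) = a].
Proof.
move=> pN kp va fa ak; have ak' : a.1 (bot k.+1) = bot k by rewrite -ak abacusK.
pose ins := @insert_hook N p k.
(* [a] pulled back along [ins], completed by vertical strands beyond column [p]. *)
pose f (x : E) : E := if width x <= p then remove_hook p k (a.1 (ins x))
  else match x with inl i => inr i | inr i => inl i end.
have fP x : width x <= p -> ins (f x) = a.1 (ins x) /\ width (f x) <= p.
  move=> xp; have [h1 h2 h3] := insert_hook_avoid pN kp xp.
  rewrite /f xp; apply: remove_hookK => //; first exact: vertical_width.
    by rewrite -ak' => /(inv_inj (@abacusK _ _ a)).
  by rewrite -ak => /(inv_inj (@abacusK _ _ a)).
have ins_inj x y : width x <= p -> width y <= p -> ins x = ins y -> x = y.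
  exact: insert_hook_inj.
have wf x : (width (f x) <= p) = (width x <= p).
  have [xp|px] := boolP (width x <= p); first by have [_ ->] := fP x xp.
  by rewrite /f (negPf px); case: x px => i /negPf.
pose s : arcs E M := (f, fun=> 0%R).
have gf : good pred0 s.
  split=> //= x; have [xp|px] := boolP (width x <= p).
  - have [e1 w1] := fP x xp; have [e2 w2] := fP _ w1.
    by apply: ins_inj => //; rewrite e2 e1 abacusK.
  - have := wf x; rewrite (negPf px) /f (negPf px) => ->.
    by case: x {px}.
  - have [e1 w1] := fP x xp; apply/eqP => efx; move: e1; rewrite efx.
    by move=> /esym; exact: abacus_neq.
  - by rewrite /f (negPf px); case: x {px}.
(* The low points occupy the two extremities of the boundary and the vertical strands are nested in
   between, so that noncrossing is at stake only between two low arcs. *)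
have low (x : E) : width x <= p -> boundary x <= p \/ (N + N).+1 - p <= boundary x.
  have [i iN [->|->]] := endpointP x; rewrite ?width_top ?width_bot ?boundary_top
    ?boundary_bot //; lia.
have high (x : E) : (width x <= p) = false -> exists2 i, p < i <= N &
    (boundary x = i /\ boundary (f x) = (N + N).+1 - i) \/
    (boundary (f x) = i /\ boundary x = (N + N).+1 - i).
  rewrite /f => px; rewrite px; move: px.
  have [i iN [->|->]] := endpointP x; rewrite ?width_top ?width_bot // => pi;
    exists i; rewrite ?iN ?ltnNge ?pi //.
    by left; rewrite boundary_top // boundary_bot.
  by right; rewrite boundary_top // boundary_bot.
have ncf : noncrossing (@boundary N.+1) s.1.
  apply/'forall_forallP => x y; apply/negP => /= /and3P[].
  have [xp|px] := boolP (width x <= p); have [yp|py] := boolP (width y <= p).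
  - have [e1 w1] := fP x xp; have [e2 w2] := fP y yp.
    rewrite -(insert_hook_mono pN kp xp yp) -(insert_hook_mono pN kp yp w1).
    rewrite -(insert_hook_mono pN kp w1 w2) -!/(ins _) e1 e2 => h1 h2 h3.
    exact: (@noncrossingP _ _ a (ins x) (ins y)).
  - have := low _ xp; have := low (f x); rewrite wf xp => /(_ isT).
    have [i ip] := high y (negPf py); lia.
  - have := low _ yp; have := low (f y); rewrite wf yp => /(_ isT).
    have [i ip] := high x (negPf px); lia.
  - have [i ip] := high x (negPf px); have [j jp] := high y (negPf py); lia.
pose b : abacus := mk_abacus gf ncf.
have bE x : b.1 x = f x by rewrite /b /= ffunE.
have vb : vertical_from p.+1 b.
  by move=> j pj jN; rewrite bE /f width_top // leqNgt pj.
have fb : flat b by move=> x; rewrite /b /= ffunE.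
exists b; split=> //.
have [h1 h2 h3] := mul_descent pN kp vb.
apply: flat_eq => //.
  by apply: flat_tprod => // i; rewrite mem_descent; lia.
move=> x; set c := b * _ in h1 h2 h3 *.
have [px|xp] := ltnP p.+1 (width x).
  have [i iN [ex|ex]] := endpointP x; move: px; rewrite ex ?width_top ?width_bot // => pi.
    by rewrite h3 // va.
  by rewrite -{1}(h3 i pi iN) -(va i pi iN) !abacusK.
have [->|/eqP nx1] := eqVneq x (bot k); first by rewrite h2.
have [->|/eqP nx2] := eqVneq x (bot k.+1); first by rewrite ak' -h2 abacusK.
have [ex wx] := remove_hookK pN kp xp nx1 nx2.
rewrite -ex h1 // bE -/(ins _) -/(ins _).
by have [-> _] := fP _ wx.
Qed.

Lemma vertical_one (a : abacus) : vertical_from 1 a -> flat a -> a = 1.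
Proof.
move=> va fa.
have a0 : a.1 (top 0) = bot 0.
  have [[|j] jN [aj|aj]] := endpointP (a.1 (top 0)) => //.
  - by have := @abacus_neq _ _ a (top 0).
  - by have := va j.+1 isT jN; rewrite -aj abacusK.
  - have := va j.+1 isT jN; rewrite -aj => /(inv_inj (@abacusK _ _ a)).
    by move=> /top_inj; lia.
have {}va i : i <= N -> a.1 (top i) = bot i.
  by case: i => [_ //|i iN]; apply: va.
apply: flat_eq => //; first exact: flat_one.
move=> x; have [i iN [->|->]] := endpointP x; first by rewrite one_top va.
by rewrite one_bot -va // abacusK.
Qed.

Lemma normal_words_surj p k (a : abacus) : p <= N -> vertical_from p.+1 a ->
  hooks_below k a -> flat a ->
  exists2 w, w \in normal_words p k & tprod hook w = a.
Proof.
elim: p k a => [|p IHp] k a pN va ha fa.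
  by exists [::]; rewrite ?inE // tprod_nil (vertical_one va).
have [ap|/eqP nap] := eqVneq (a.1 (top p.+1)) (bot p.+1).
  have [||||w wk <-] := IHp k a => //; first exact: ltnW.
    move=> j; rewrite leq_eqVlt => /orP[/eqP <-|] // pj; exact: va.
  by exists w => //; rewrite /= mem_cat wk.
(* The last letter of the final descent has to be the greatest position of a hook. *)
pose P m := (m <= p) && (a.1 (bot m) == bot m.+1).
have exP : exists m, P m.
  by have [m mp am] := exists_hook pN va nap; exists m; rewrite /P mp am eqxx.
have leP m : P m -> m <= p by case/andP.
case: (ex_maxnP exP leP) => m /andP[mp /eqP am] maxm.
have ham i : i < N -> a.1 (bot i) = bot i.+1 -> i <= m.
  move=> iN ai; apply: maxm; rewrite /P ai eqxx andbT.
  by have := vertical_hook va iN ai.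
have [b [vb fb eb]] := remove_hook_diagram pN mp va fa am.
(* Inserting the hook back would turn a hook of [b] at [i >= m] into a hook of [a] at [i.+2 > m],
   or, when [i.+1 = p], into a vertical strand at [p.+1]. *)
have hb : hooks_below m b.
  move=> i iN bi; rewrite ltnNge; apply/negP => mi.
  have ip := vertical_hook vb iN bi.
  have [h1 _ _] := mul_descent pN mp vb; rewrite eb in h1.
  have := h1 (bot i); rewrite bi width_bot; [|lia].
  rewrite insert_hook_hi; [|lia..] => /(_ (ltnW ip)) e.
  have [ip'|pi] := ltnP i.+1 p.
    move: e; rewrite insert_hook_hi; [|lia..] => e.
    by have := ham i.+2; rewrite e => /(_ _ erefl); lia.
  have ep : i.+1 = p by lia.
  move: e; rewrite ep insert_hook_last; [|lia..] => e.
  by apply: nap; rewrite -e abacusK.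
have [w wm ew] := IHp m b (ltnW pN) vb hb fb.
exists (w ++ descent p.+1 m); last by rewrite tprod_cat ew.
apply/mem_normal_words; right; exists p => //; right; exists m, w; split=> //.
by apply: ha => //; lia.
Qed.

End NormalWordsSurjective.

(** * Counting *)

Lemma size_normal_wordsS p k : size (normal_words p.+1 k) =
  size (normal_words p k) + \sum_(0 <= j < minn k p.+1) size (normal_words p j).
Proof.
by rewrite /= size_cat size_allpairs_dep /index_iota subn0 sumnE big_map.
Qed.

Lemma size_normal_words0 p : size (normal_words p 0) = 1.
Proof. by elim: p => // p IHp; rewrite size_normal_wordsS IHp min0n big_geq. Qed.

Lemma size_normal_words_rec p k : k <= p -> size (normal_words p.+1 k.+1) =
  size (normal_words p k.+1) + size (normal_words p.+1 k).
Proof.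
move=> kp; rewrite !size_normal_wordsS (minn_idPl (kp : k.+1 <= p.+1)).
rewrite (minn_idPl (leqW kp)) big_nat_recr //=; lia.
Qed.

(** Ballot numbers, with the subtracted binomial on the left. Pascal's rule matches the recursion;
    at [k = p] the bound on last letters saturates and the symmetry of binomials takes over. *)
Lemma size_normal_words p k : k <= p ->
  size (normal_words p k.+1) + 'C(p + k.+2, k) = 'C(p + k.+2, k.+1).
Proof.
elim: p k => [|p IHp]; first by case.
elim=> [_|k IHk kp].
  rewrite size_normal_words_rec // size_normal_words0.
  have := IHp 0 (leq0n p); rewrite !bin0 !bin1; lia.
have [kp'|pk] := ltnP k p.
  rewrite size_normal_words_rec //.
  have := IHp k.+1 kp'; have := IHk (ltnW kp).
  rewrite (_ : p.+1 + k.+2 = (p + k.+3)); last lia.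
  rewrite (_ : p.+1 + k.+3 = (p + k.+3).+1); last lia.
  rewrite !binS; lia.
have ek : k = p by lia.
rewrite {k kp pk}ek in IHk *.
have -> : size (normal_words p.+1 p.+2) = size (normal_words p.+1 p.+1).
  by rewrite normal_words_min; congr (size (normal_words _ _)); lia.
have := IHk (leqnSn p); have eX : p.+1 + p.+3 = (p.+1 + p.+2).+1 by lia.
have : 'C(p.+1 + p.+2, p.+2) = 'C(p.+1 + p.+2, p.+1).
  by rewrite -bin_sub ?addnK //; lia.
by rewrite eX; move: (p.+1 + p.+2) => X; rewrite !binS; lia.
Qed.

Lemma size_normal_words_catalan N : size (normal_words N N) = catalan N.+1.
Proof.
have -> : size (normal_words N N) = size (normal_words N N.+1).
  by rewrite (normal_words_min N N.+1); congr (size (normal_words _ _)); lia.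
apply/eqP; rewrite -(@eqn_pmul2l N.+2) // catalanE.
have := size_normal_words (leqnn N).
(* This gives [(N+1) 'C(2N+2, N+1) = (N+2) 'C(2N+2, N)], so that [N+2] times the difference of the
   two binomials is ['C(2N+2, N+1)]. *)
have := mul_bin_left N.+1.*2 N.
rewrite (_ : N + N.+2 = N.+1.*2); last by rewrite -addnn; lia.
rewrite (_ : N.+1.*2 - N = N.+2); last by rewrite -addnn; lia.
move=> e1 e2; apply/eqP.
have : N.+2 * (size (normal_words N N.+1) + 'C(N.+1.*2, N)) = N.+2 * 'C(N.+1.*2, N.+1).
  by rewrite e2.
rewrite mulnDr -e1; set x := 'C(_, N.+1); rewrite (_ : N.+2 * x = N.+1 * x + x); lia.
Qed.

(** * Cardinality of the abacus monoid *)

Section AbacusCount.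
Variables N d : nat.
Hypothesis d_gt0 : 0 < d.
Local Notation E := (endpoint N.+1).
Local Notation M := (residue d).
Local Notation abacus := (abacusJones N.+1 d).
Local Notation hook := (@hook N d).

(** The letter [p] tells the two halves of the list apart; within the second one, equal words have
    equal diagrams, from which [j] and [v] are recovered. *)
Lemma normal_words_uniq p k : p <= N -> uniq (normal_words p k).
Proof.
elim: p k => [//|p IHp] k pN; rewrite /= cat_uniq IHp 1?ltnW //=.
apply/andP; split.
  apply/hasPn => w /allpairsPdep[j [v [jk vj ->]]]; apply/negP => wk.
  have jp : j <= p by move: jk; rewrite mem_iota; lia.
  have := normal_words_lt (i := p) wk; rewrite mem_cat mem_descent.
  by rewrite jp ltnS leqnn orbT ltnn => /(_ isT).
apply: allpairs_uniq_dep; first exact: iota_uniq.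
  by move=> j _; apply: IHp; exact: ltnW.
move=> [j v] [j' v'] /allpairsPdep[j1 [v1 [j1k v1j [-> ev1]]]].
move=> /allpairsPdep[j2 [v2 [j2k v2j [-> ev2]]]] /=.
rewrite ev1 ev2 => e.
have j1p : j1 <= p by move: j1k; rewrite mem_iota; lia.
have j2p : j2 <= p by move: j2k; rewrite mem_iota; lia.
have [e12 evv] := tprod_descent_eq pN j1p j2p v1j v2j (congr1 (tprod hook) e).
rewrite -{}e12 in v2j *; congr (Tagged _ _).
exact: normal_words_inj (ltnW pN) v1j v2j evv.
Qed.

(** Selects one end of each arc, so that beads can be recorded once per arc. *)
Definition opener (a : abacus) (x : E) : bool := boundary x < boundary (a.1 x).

Lemma openerC (a : abacus) x : opener a (a.1 x) = ~~ opener a x.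
Proof.
rewrite /opener abacusK -leqNgt [RHS]leq_eqVlt.
by case: eqP => [/boundary_inj e|//]; have := @abacus_neq _ _ a x.
Qed.

Lemma card_opener (a : abacus) : #|[pred x | opener a x]| = N.+1.
Proof.
have : #|[pred x | opener a x]| + #|[predC [pred x | opener a x]]| = N.+1 + N.+1.
  by rewrite cardC card_sum card_ord.
have -> : #|[predC [pred x | opener a x]]| = #|[pred x | opener a x]|.
  rewrite -(fintype.card_image (inv_inj (@abacusK _ _ a)) [pred x | opener a x]).
  apply: eq_card => x; rewrite -[x in RHS](abacusK a) fintype.mem_image; last first.
    exact: inv_inj (@abacusK _ _ a).
  by rewrite !inE openerC.
by lia.
Qed.

Definition flatb (a : abacus) : bool := [forall x, a.2 x == 0%R].

Lemma flatP a : reflect (flat a) (flatb a).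
Proof. exact: 'forall_eqP. Qed.

Lemma card_flat : #|[pred a : abacus | flatb a]| = catalan N.+1.
Proof.
rewrite -size_normal_words_catalan -(size_map (tprod hook)).
have un : uniq (map (tprod hook) (normal_words N N)).
  rewrite map_inj_in_uniq ?normal_words_uniq // => w w' wN w'N.
  exact: normal_words_inj wN w'N.
rewrite -(card_uniqP un); apply: eq_card => a; rewrite !inE.
apply/flatP/mapP => [fa|[w wN ->]]; last first.
  by have [] := normal_words_diagram d (leqnn N) wN.
have [||w wN <-] := @normal_words_surj N d N N a (leqnn N) _ _ fa.
- by move=> j; rewrite ltnNge => /negPf ->.
- by [].
by exists w.
Qed.

Lemma flatten_proof (a : abacus) : good pred0 (a.1 : E -> E, fun=> 0%R : M).
Proof. by have [h1 h2 _] := abacus_good a. Qed.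

Definition flatten_abacus (a : abacus) : abacus :=
  mk_abacus (flatten_proof a) (abacus_noncrossing a).

Lemma flatten_arcs a : (flatten_abacus a).1 =1 a.1.
Proof. by move=> x; rewrite ffunE. Qed.

Lemma flat_flatten a : flat (flatten_abacus a).
Proof. by move=> x; rewrite ffunE. Qed.

Lemma card_abacus : #|{: abacusJones N.+1 d}| = (d ^ N.+1 * catalan N.+1)%N.
Proof.
(* Diagrams are sorted by their arcs; the fibre over a bead-free [a] corresponds, through [fill], to
   the functions from the [N.+1] openers to residues. *)
rewrite -sum1_card (partition_big flatten_abacus flatb) /=; last first.
  by move=> a _; apply/flatP; exact: flat_flatten.
rewrite -card_flat mulnC -sum_nat_const; apply: eq_bigr => a /flatP fa.
rewrite sum1dep_card.
have -> : (d ^ N.+1 = #|{ffun {x : E | opener a x} -> M}|)%N.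
  by rewrite card_ffun card_ord prednK // card_sig card_opener.
have op x : ~~ opener a x -> opener a (a.1 x) by rewrite openerC.
(* The default [0] is never reached: one of [x] and [a.1 x] is an opener. *)
pose beads (g : {ffun {x : E | opener a x} -> M}) (x : E) : M :=
  if insub x is Some u then g u else if insub (a.1 x) is Some u then g u else 0%R.
have beadsC g x : beads g (a.1 x) = beads g x.
  rewrite /beads abacusK; case: insubP => [u ua _|/negPf na].
    case: insubP => [v va _|//]; by move: ua; rewrite openerC va.
  by case: insubP.
have gb g : good pred0 (a.1 : E -> E, beads g).
  by have [h1 h2 _] := abacus_good a; split=> // x; exact: beadsC.
pose fill g : abacus := mk_abacus (gb g) (abacus_noncrossing a).
have fill_inj : injective fill.
  move=> g g' e; apply/ffunP => u.
  have : (fill g).2 (val u) = (fill g').2 (val u) by rewrite e.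
  by rewrite !ffunE /= /beads valK.
rewrite -(card_codom fill_inj); apply: eq_card => b; rewrite !inE.
apply/eqP/codomP => [eb|[g ->]]; last first.
  apply: flat_eq => //; first exact: flat_flatten.
  by move=> x; rewrite flatten_arcs ffunE.
have [_ _ bdb] := abacus_good b.
have eb1 x : b.1 x = a.1 x by rewrite -eb flatten_arcs.
exists [ffun u => b.2 (val u)]; apply: abacus_eq; split=> x /=.
  by rewrite ffunE eb1.
rewrite ffunE /= /beads; case: insubP => [u _ <-|/op]; first by rewrite ffunE.
case: insubP => [u _ eu _|/negPf -> //]; rewrite ffunE eu -eb1.
exact: bdb.
Qed.

End AbacusCount.

(** * Beads *)

Section FramedWords.
Variables N d : nat.
Hypothesis d_gt0 : 0 < d.
Local Notation E := (endpoint N.+1).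
Local Notation M := (residue d).
Local Notation abacus := (abacusJones N.+1 d).
Local Notation J := (framedJones N.+1 d).
Local Notation hook := (@hook N d).
Local Notation psi := (@psi N.+1 d).
Local Notation t_ := (@gen_t N.+1 d).
Local Notation z_ := (@gen_z N.+1 d).
Local Open Scope group_scope.

Lemma word_rel (u v : seq (framed_letter N.+1)) :
  framed_rel d u v -> word (@framed_rel N.+1 d) u = word (@framed_rel N.+1 d) v.
Proof. by move=> uv; apply/wordP/cong_rel. Qed.

Lemma gen_word (l : framed_letter N.+1) w :
  gen (@framed_rel N.+1 d) l * word (@framed_rel N.+1 d) w =
  word (@framed_rel N.+1 d) (l :: w).
Proof. exact: word_cat. Qed.

Lemma gen_gen (l m : framed_letter N.+1) :
  gen (@framed_rel N.+1 d) l * gen (@framed_rel N.+1 d) m =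
  word (@framed_rel N.+1 d) [:: l; m].
Proof. exact: word_cat. Qed.

Lemma t_idem i : t_ i * t_ i = t_ i.
Proof. by rewrite gen_gen; apply: word_rel; constructor. Qed.

Lemma t_comm (i j : 'I_N) : i.+1 < j -> t_ i * t_ j = t_ j * t_ i.
Proof. by move=> ij; rewrite !gen_gen; apply: word_rel; constructor; rewrite ij. Qed.

Lemma t_braid (i j : 'I_N) : (i.+1 == j) || (j.+1 == i) -> t_ i * t_ j * t_ i = t_ i.
Proof.
by move=> ij; rewrite -mulgA gen_gen gen_word; apply: word_rel; constructor.
Qed.

Lemma z_comm i j : z_ i * z_ j = z_ j * z_ i.
Proof. by rewrite !gen_gen; apply: word_rel; constructor. Qed.

Lemma tz_slide i : t_ i * z_ (ord_lo i) = t_ i * z_ (ord_hi i).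
Proof. by rewrite !gen_gen; apply: word_rel; constructor. Qed.

Lemma zt_slide i : z_ (ord_lo i) * t_ i = z_ (ord_hi i) * t_ i.
Proof. by rewrite !gen_gen; apply: word_rel; constructor. Qed.

Lemma zt_comm i j : i != ord_lo j -> i != ord_hi j -> z_ i * t_ j = t_ j * z_ i.
Proof. by move=> h1 h2; rewrite !gen_gen; apply: word_rel; constructor. Qed.

Lemma z_expg i k : z_ i ^+ k = word (@framed_rel N.+1 d) (nseq k (zl i)).
Proof. by elim: k => [//|k IHk]; rewrite expgS IHk gen_word. Qed.

Lemma z_order i : z_ i ^+ d = 1.
Proof. by rewrite z_expg; apply: word_rel; constructor. Qed.

Lemma tzt_absorb i k : t_ i * z_ (ord_lo i) ^+ k * t_ i = t_ i.
Proof.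
rewrite z_expg -mulgA.
have -> : word (@framed_rel N.+1 d) (nseq k (zl (ord_lo i))) * t_ i =
    word (@framed_rel N.+1 d) (nseq k (zl (ord_lo i)) ++ [:: tl i]) by exact: word_cat.
by rewrite gen_word; apply: word_rel; constructor.
Qed.

Definition tgen (i : nat) : J :=
  if insub i is Some j then @gen_t N.+1 d j else 1.

Lemma tgenE (i : nat) (iN : i < N) : tgen i = t_ (Ordinal iN).
Proof. by rewrite /tgen insubT. Qed.

Lemma psi_tgen i : psi (tgen i) = hook i.
Proof.
have [iN|Ni] := ltnP i N; first by rewrite tgenE psi_t ?hookE.
by rewrite /tgen hook_out // insubF ?psi1 // ltnNge Ni.
Qed.

Lemma psi_tprod w : psi (tprod tgen w) = tprod hook w.
Proof.
elim: w => [|i w IHw]; first by rewrite !tprod_nil psi1.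
by rewrite !tprod_cons psiM // psi_tgen IHw.
Qed.

Lemma tgen_normal_form w : {in w, forall i, i < N} ->
  exists2 v, v \in normal_words N N & tprod tgen w = tprod tgen v.
Proof.
apply: (@normal_formP _ tgen N) => //.
- by move=> i iN; rewrite !tgenE t_idem.
- by move=> i j iN jN ij; rewrite !tgenE t_comm.
- by move=> i iN; rewrite !tgenE ?(ltnW iN) // => iN'; rewrite t_braid //= eqxx.
- by move=> i iN; rewrite !tgenE ?(ltnW iN) // => iN'; rewrite t_braid //= eqxx orbT.
Qed.

Lemma tprod_eq w w' : {in w, forall i, i < N} -> {in w', forall i, i < N} ->
  tprod hook w = tprod hook w' -> tprod tgen w = tprod tgen w'.
Proof.
move=> /tgen_normal_form[v vN e] /tgen_normal_form[v' v'N e'].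
rewrite -!psi_tprod e e' !psi_tprod => /(normal_words_inj (leqnn N) vN v'N).
by move=> ->.
Qed.

Lemma tprod_surj (a : abacus) : flat a ->
  exists2 w, {in w, forall i, i < N} & tprod hook w = a.
Proof.
move=> fa; have [||w wN <-] := @normal_words_surj N d N N a (leqnn N) _ _ fa.
- by move=> j; rewrite ltnNge => /negPf ->.
- by [].
by exists w => // i; exact: normal_words_lt wN.
Qed.

(* The algebraic counterpart of adding a bead to the arc ending at [x]. *)
Definition act (x : E) (y : J) : J :=
  match x with inl i => z_ i * y | inr i => y * z_ i end.

Lemma actC x x' y : act x (act x' y) = act x' (act x y).
Proof.
case: x x' => [i|i] [j|j] /=; last by rewrite -!mulgA z_comm.
- by rewrite !mulgA z_comm.
- by rewrite mulgA.
- by rewrite mulgA.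
Qed.

Lemma iter_act_inl i k y : iter k (act (inl i)) y = z_ i ^+ k * y.
Proof. exact: iter_mulg. Qed.

Lemma iter_act_inr i k y : iter k (act (inr i)) y = y * z_ i ^+ k.
Proof.
by elim: k => [|k IHk]; rewrite ?expg0 ?mulg1 //= IHk -mulgA -expgSr.
Qed.

Lemma iter_act_order x y : iter d (act x) y = y.
Proof.
by case: x => i; rewrite ?iter_act_inl ?iter_act_inr z_order ?mul1g ?mulg1.
Qed.

Lemma iter_act_mod x k y : iter (k %% d) (act x) y = iter k (act x) y.
Proof.
rewrite [in RHS](divn_eq k d) iterD.
elim: (k %/ d) => // q IHq; rewrite mulSn iterD iter_act_order.
exact: IHq.
Qed.

Lemma act_iterC x x' k y : act x (iter k (act x') y) = iter k (act x') (act x y).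
Proof. by elim: k => //= k IHk; rewrite actC IHk. Qed.

Lemma act_t x y j : x <> inr (ord_lo j) -> x <> inr (ord_hi j) ->
  act x (y * t_ j) = act x y * t_ j.
Proof.
case: x => i /= h1 h2; first by rewrite mulgA.
by rewrite -!mulgA zt_comm //; apply/eqP => e; [apply: h1|apply: h2]; rewrite e.
Qed.

Lemma iter_act_t x k y j : x <> inr (ord_lo j) -> x <> inr (ord_hi j) ->
  iter k (act x) (y * t_ j) = iter k (act x) y * t_ j.
Proof. by move=> h1 h2; elim: k => //= k ->; rewrite act_t. Qed.

(** Beads slide along arcs inside the framed monoid, the arcs being those of the diagram of the
    word. *)
Lemma act_arc w x : {in w, forall i, i < N} ->
  act ((tprod hook w).1 x) (tprod tgen w) = act x (tprod tgen w).
Proof.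
elim/last_ind: w x => [|w i IHw] x h.
  rewrite !tprod_nil; have [k kN [->|->]] := endpointP x.
    by rewrite one_top /= mulg1 mul1g.
  by rewrite one_bot /= mulg1 mul1g.
have {}IHw x' := IHw x' (fun j jw => h j (etrans (mem_rcons _ _ _) (predU1r _ _ jw))).
have iN : i < N by apply: h; rewrite mem_rcons mem_head.
rewrite !tprod_rcons; set b := tprod hook w in IHw *; set y := tprod tgen w in IHw *.
rewrite (tgenE iN); set j := Ordinal iN.
have lo : inr (ord_lo (j : 'I_N.+1.-1)) = bot N i.
  by rewrite /bot; congr inr; apply: ord_inj; rewrite inordK //= ltnW.
have hi : inr (ord_hi (j : 'I_N.+1.-1)) = bot N i.+1.
  by rewrite /bot; congr inr; apply: ord_inj; rewrite inordK.
have slide : act (bot N i) (y * t_ j) = act (bot N i.+1) (y * t_ j).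
  by rewrite -lo -hi /= -!mulgA tz_slide.
have slide' : act (bot N i) y * t_ j = act (bot N i.+1) y * t_ j.
  by rewrite -lo -hi /= -!mulgA zt_slide.
have at_lo := mul_hook_at b iN.
have [->|/eqP x1] := eqVneq x (bot N i); first by rewrite at_lo slide.
have [->|/eqP x2] := eqVneq x (bot N i.+1); first by rewrite -at_lo abacusK slide at_lo.
rewrite mul_hook_off //.
have off u : u <> bot N i -> u <> bot N i.+1 -> act u (y * t_ j) = act u y * t_ j.
  by rewrite -lo -hi; exact: act_t.
rewrite [RHS]off //.
(* The last letter merges the arc of [x] with another one: the bead follows the first to [bot N i],
   crosses to [bot N i.+1] by [zt_slide], and goes on along the second. *)
case: eqP => [bx|bx1].
  have n1 : b.1 (bot N i.+1) <> bot N i.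
    by move=> e; apply: x2; rewrite -[x](abacusK b) bx -e abacusK.
  by rewrite (off _ n1 (@abacus_neq _ _ _ _)) IHw -slide' -bx IHw.
case: eqP => [bx|bx2]; last by rewrite off // IHw.
have n1 : b.1 (bot N i) <> bot N i.+1.
  by move=> e; apply: x1; rewrite -[x](abacusK b) bx -e abacusK.
by rewrite (off _ (@abacus_neq _ _ _ _) n1) IHw slide' -bx IHw.
Qed.

Lemma iter_act_arc w x k : {in w, forall i, i < N} ->
  iter k (act ((tprod hook w).1 x)) (tprod tgen w) = iter k (act x) (tprod tgen w).
Proof.
by move=> h; elim: k => //= k ->; rewrite act_iterC act_arc // -act_iterC.
Qed.

(** All beads have been pushed out to endpoints, but may still sit at both ends of an arc and exceed
    [d]. *)
Definition beaded (y : J) := exists l w, {in w, forall i, i < N} /\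
  y = foldr act (tprod tgen w) l.

Lemma beaded_act x y : beaded y -> beaded (act x y).
Proof. by move=> [l [w [h ->]]]; exists (x :: l), w. Qed.

Lemma beaded_iter x k y : beaded y -> beaded (iter k (act x) y).
Proof. by move=> by_; elim: k => //= k; exact: beaded_act. Qed.

Lemma beaded_tprod w : {in w, forall i, i < N} -> beaded (tprod tgen w).
Proof. by move=> h; exists [::], w. Qed.

(** The exponent [k] gathers the beads of [y] located at the two feet of [t_j], the only ones that
    do not commute out; those at [ord_hi j] are first moved to [ord_lo j]. *)
Lemma beaded_zt y j k : beaded y -> beaded (y * z_ (ord_lo j) ^+ k * t_ j).
Proof.
move=> [l [w [h ->]]]; elim: l k => [|x l IHl] k /=.
  rewrite -iter_act_inr -(iter_act_arc _ _ h).
  set b := tprod hook w.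
  have jN := ltn_ord j.
  have tj : t_ j = tgen j by rewrite tgenE; congr t_; apply: ord_inj.
  have hj : {in rcons w j, forall i, i < N}.
    by move=> i; rewrite mem_rcons inE => /orP[/eqP->|/h].
  have lo : inr (ord_lo j) = bot N j.
    by rewrite /bot; congr inr; apply: ord_inj; rewrite inordK //= ltnW.
  have hi : inr (ord_hi j) = bot N j.+1.
    by rewrite /bot; congr inr; apply: ord_inj; rewrite inordK.
  (* If [t_j] closes the arc of these beads into a loop, appending [j] does not change the diagram,
     hence not the word by [tprod_eq], and [tzt_absorb] discards the beads. *)
  have [bj|bj] := eqVneq (b.1 (inr (ord_lo j))) (inr (ord_hi j)).
    have e : tprod tgen w = tprod tgen (rcons w j).
      apply: tprod_eq => //; rewrite tprod_rcons -/b.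
      have fb : flat b.
        rewrite /b -[tprod _ _]mul1g; apply: flat_tprod => //; exact: flat_one.
      have : flat_hook b j by split=> //; exact: fb.
      move=> /flat_hook_t {1}<-; rewrite hookE.
      by congr (_ * abacus_t _ _); apply: ord_inj.
    rewrite (iter_act_arc _ _ h) e iter_act_inr tprod_rcons -tj -!mulgA.
    rewrite (mulgA (t_ j)) tzt_absorb tj -tprod_rcons.
    exact: beaded_tprod.
  (* Otherwise the beads, slid to the other end of their arc, are away from [t_j] and get out. *)
  rewrite -iter_act_t; last exact/eqP.
    by apply: beaded_iter; rewrite tj -tprod_rcons; exact: beaded_tprod.
  exact: abacus_neq.
case: x => i /=.
  by rewrite -!mulgA; apply: (beaded_act (inl i)); rewrite !mulgA; exact: IHl.
have [->|i1] := eqVneq i (ord_lo j); first by rewrite -[_ * z_ _ * _]mulgA -expgS; exact: IHl.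
have zc : z_ i * z_ (ord_lo j) ^+ k = z_ (ord_lo j) ^+ k * z_ i.
  exact: commuteX (z_comm _ _).
rewrite -[_ * z_ _ * _]mulgA zc [_ * (_ * z_ i)]mulgA -[_ * z_ i * _]mulgA.
have [->|i2] := eqVneq i (ord_hi j).
  by rewrite -zt_slide mulgA -[_ * _ * z_ _]mulgA -expgSr; exact: IHl.
by rewrite zt_comm // mulgA; apply: (beaded_act (inr i)); exact: IHl.
Qed.

Lemma beadedP y : beaded y.
Proof.
have [w ->] := word_surj y; elim/last_ind: w => [|w l IHw].
  by have := @beaded_tprod [::]; rewrite tprod_nil; apply.
have -> : word (@framed_rel N.+1 d) (rcons w l) =
    word (@framed_rel N.+1 d) w * gen (@framed_rel N.+1 d) l.
  by rewrite -cats1; symmetry; exact: word_cat.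
case: l => [j|j]; last exact: (beaded_act (inr j)).
by have := beaded_zt j 0 IHw; rewrite expg0 mulg1.
Qed.

End FramedWords.

(** * Bijectivity of [psi] *)

Section Isomorphism.
Variables N d : nat.
Hypothesis d_gt0 : 0 < d.
Local Notation E := (endpoint N.+1).
Local Notation M := (residue d).
Local Notation abacus := (abacusJones N.+1 d).
Local Notation J := (framedJones N.+1 d).
Local Notation hook := (@hook N d).
Local Notation tgen := (@tgen N d).
Local Notation psi := (@psi N.+1 d).
Local Notation act := (@act N d).
Local Open Scope group_scope.

Lemma psi_act x y : sim id (arcs_of (psi (act x y)))
  (add_beads (arcs_of (psi y)) (point_bead d x)).
Proof.
case: x => i /=; rewrite psiM // psi_z //; last exact: abacus_mul_o.
have [w ->] := word_surj y; rewrite psi_word //.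
(* A bead on the top line is a left factor, whereas only right multiplications are known: its effect
   is followed letter by letter, starting from the identity diagram. *)
elim/last_ind: w => [|w l IHw].
  rewrite abacus_word0 mulg1; split=> -[j|j]; rewrite /= !ffunE //.
    by rewrite GRing.add0r GRing.addr0.
  by rewrite !GRing.add0r.
rewrite -cats1 abacus_word_cat abacus_word1 mulgA.
case: l => j /=.
  apply: (sim_id_trans (abacus_mul_t _ j)); apply: sim_id_sym.
  apply: (sim_id_trans (sim_add_beads (abacus_mul_t _ j) (fun=> erefl))).
  apply: sim_id_sym; apply: (sim_id_trans (sim_hook_join _ _ IHw)).
  by apply: hook_join_add_beads => //; [exact: abacus_good|exact: bot_lo_hi].
apply: (sim_id_trans (abacus_mul_o _ j)); apply: sim_id_sym.
apply: (sim_id_trans (sim_add_beads (abacus_mul_o _ j) (fun=> erefl))).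
apply: sim_id_sym; apply: (sim_id_trans (sim_add_beads IHw (fun=> erefl))).
exact: add_beadsC.
Qed.

Lemma psi_iter_act x k y : sim id (arcs_of (psi (iter k (act x) y)))
  (add_beads (arcs_of (psi y)) (bead (inZp k) x)).
Proof.
elim: k => [|k IHk] /=; first exact/sim_id_sym/add_beads0/bead_inZp0.
apply: (sim_id_trans (psi_act _ _)).
apply: (sim_id_trans (sim_add_beads IHk (fun=> erefl))).
exact/add_beadsD/bead_inZpS.
Qed.

(** When [r] lists the openers, there is one exponent per arc, already reduced modulo [d]; this is
    the canonical form of an element. *)
Definition place (b : E -> M) (r : seq E) (y : J) : J :=
  foldr (fun x y => iter (b x) (act x) y) y r.

Lemma eq_place b b' r y : {in r, b =1 b'} -> place b r y = place b' r y.
Proof.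
elim: r => //= x r IHr e; rewrite e ?mem_head // IHr // => u ur.
by apply: e; rewrite inE ur orbT.
Qed.

Lemma psi_place b r y : uniq r -> sim id (arcs_of (psi (place b r y)))
  (add_beads (arcs_of (psi y)) (fun x => if x \in r then b x else 0%R)).
Proof.
elim: r => [_|x r IHr /= /andP[xr ur]].
  exact/sim_id_sym/add_beads0.
apply: (sim_id_trans (psi_iter_act _ _ _)).
apply: (sim_id_trans (sim_add_beads (IHr ur) (fun=> erefl))).
apply: add_beadsD => v; rewrite inE /bead valZpK.
case: eqP => [->|_] /=; last by rewrite GRing.addr0.
by rewrite (negPf xr) GRing.add0r.
Qed.

Lemma act_place b r y x : uniq r -> x \in r ->
  exists b', act x (place b r y) = place b' r y.
Proof.
elim: r => // u r IHr /= /andP[ur ur']; rewrite inE.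
case: eqP => [-> _|xu /= xr].
  exists (fun v => if v == u then inZp (b u).+1 else b v); rewrite eqxx.
  rewrite -(@eq_place b) => [|v vr]; last first.
    by case: eqP => // e; rewrite -e vr in ur.
  rewrite /= -[act u _]/(iter (b u).+1 (act u) _) -iter_act_mod.
  by congr (iter (_ %% _)); rewrite prednK.
have [b' e] := IHr ur' xr.
exists (fun v => if v == u then b u else b' v); rewrite eqxx act_iterC e.
congr iter; apply: eq_place => v vr.
by case: eqP => // ev; rewrite -ev vr in ur.
Qed.

Lemma act_place_iter b r y x x' : act x y = act x' y ->
  act x (place b r y) = act x' (place b r y).
Proof. by move=> e; elim: r => //= u r IHr; rewrite !act_iterC IHr. Qed.

Definition openers (a : abacus) : seq E := enum [pred x | opener a x].

Lemma mem_openers a x : (x \in openers a) = opener a x.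
Proof. by rewrite mem_enum. Qed.

Lemma openers_uniq a : uniq (openers a).
Proof. exact: enum_uniq. Qed.

(* Beads are slid to the first end of their arc. *)
Lemma placeP (y : J) : exists w b, {in w, forall i, i < N} /\
  y = place b (openers (tprod hook w)) (tprod tgen w).
Proof.
have [l [w [h ->]]] := beadedP d_gt0 y; elim: l => [|x l [w' [b [h' IHl]]]] /=.
  exists w, (fun=> 0%R); split=> //.
  by elim: (openers _) => //= u r <-.
rewrite IHl; have [ox|nx] := boolP (opener (tprod hook w') x).
  have [|b' ->] := @act_place b _ (tprod tgen w') x (openers_uniq (tprod hook w')).
    by rewrite mem_openers.
  by exists w', b'.
rewrite -(act_place_iter _ _ (@act_arc N d w' x h')).
have [|b' ->] := @act_place b _ (tprod tgen w') ((tprod hook w').1 x)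
    (openers_uniq (tprod hook w')).
  by rewrite mem_openers openerC.
by exists w', b'.
Qed.

Lemma tprod_flat w : {in w, forall i, i < N} -> flat (tprod hook w).
Proof. by move=> h; rewrite -[tprod _ _]mul1g; apply: flat_tprod => //; exact: flat_one. Qed.

Lemma psi_place_openers b w : {in w, forall i, i < N} ->
  let a := tprod hook w in let p := psi (place b (openers a) (tprod tgen w)) in
  p.1 =1 a.1 /\ forall x, p.2 x = if opener a x then b x else b (a.1 x).
Proof.
move=> h a p; have [e1 e2] := psi_place b (tprod tgen w) (openers_uniq a).
rewrite psi_tprod // in e1 e2.
split=> x; first exact/esym/e1.
have := e2 x; rewrite /= -/p => <-; rewrite !mem_openers openerC.
rewrite (tprod_flat h) GRing.add0r.
by case: ifP => _; rewrite ?GRing.addr0 ?GRing.add0r.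
Qed.

(** Both data of the canonical form are read off the diagram: its arcs determine the word up to
    [tprod_eq], and its beads at the openers are the values of [b] that count. *)
Lemma psi_inj : injective psi.
Proof.
move=> y y'; have [w [b [h ->]]] := placeP y; have [w' [b' [h' ->]]] := placeP y'.
have [] := psi_place_openers b h; have [] := psi_place_openers b' h'.
set p := psi _; set p' := psi _ => e1 e2 e1' e2' pp.
have ew : tprod hook w = tprod hook w'.
  apply: flat_eq; [exact: tprod_flat|exact: tprod_flat|].
  by move=> x; rewrite -e1 -e1' pp.
rewrite ew (tprod_eq d_gt0 h h' ew); apply: eq_place => x.
by rewrite mem_openers => ox; have := e2' x; rewrite pp e2 ew ox.
Qed.

Lemma psi_surj (a : abacus) : exists y, psi y = a.
Proof.
have [w h ew] := tprod_surj (@flat_flatten N d a).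
exists (place a.2 (openers (tprod hook w)) (tprod tgen w)).
have [e1 e2] := psi_place_openers a.2 h.
have ea x : (tprod hook w).1 x = a.1 x by rewrite ew flatten_arcs.
have [_ _ bda] := abacus_good a.
apply: abacus_eq; split=> x /=; first by rewrite e1 ea.
by rewrite e2 ea; case: ifP => // _; exact/esym/bda.
Qed.

Lemma psi_bij : bijective psi.
Proof.
have /boolp.choice[g gK] := psi_surj.
by exists g => // y; apply: psi_inj; rewrite gK.
Qed.

Lemma card_framedJones :
  ([set: J]%classic #= `I_(d ^ N.+1 * catalan N.+1))%card.
Proof.
rewrite -(card_abacus N d_gt0); apply/card_set_bijP.
exists (fun y => enum_rank (psi y) : nat); split.
- by move=> y _ /=; exact: ltn_ord.
- by move=> y y' _ _ /ord_inj/enum_rank_inj/psi_inj.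
- move=> i /= lt_i; have [y e] := psi_surj (enum_val (Ordinal lt_i)).
  by exists y; rewrite // e enum_valK.
Qed.

End Isomorphism.

Theorem theorem3p1 (n d : nat) (n_ge1 : 1 <= n) (d_ge1 : 1 <= d) :
  (exists psi : UMagmaMorphism.type (framedJones n d) (abacusJones n d),
     [/\ bijective psi,
         forall i : 'I_n.-1, psi (gen_t d i) = abacus_t d i
       & forall j : 'I_n, psi (gen_z d j) = abacus_o d j]) /\
  ([set: framedJones n d]%classic #= `I_(d ^ n * catalan n))%card.
Proof.
case: n n_ge1 => // N _; split; last exact: card_framedJones.
pose mor := isMultiplicative.Build _ _ (@psi N.+1 d) (psiM d_ge1).
pose mor1 := Multiplicative_isUMagmaMorphism.Build _ _ (@psi N.+1 d) (psi1 N.+1 d_ge1).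
pose f : UMagmaMorphism.type (framedJones N.+1 d) (abacusJones N.+1 d) :=
  HB.pack (@psi N.+1 d) mor mor1.
exists f; split; first exact: psi_bij.
- exact: psi_t.
- exact: psi_z.
Qed.
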